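(* Let $\mu$ be a $(\mathcal{T},\alpha,\phi)$-tile-standard permuton. Let $\mathcal{I}_n^\mu$ be the minimal inversion of $n$ i.i.d. points distributed according to $\mu$, and let $\Delta=\{(x,y)\in[0,1]^2:x+y\le1\}$. Then, as $n\to\infty$, $n^{-\alpha/(\alpha+1)}\,\mathcal{I}_n^\mu$ converges in distribution to the $\mathrm{Rayleigh}\left(\alpha+1,\,M_{\mathcal{T}}+\int_\Delta\phi\right)$ distribution, where $M_{\mathcal{T}}$ is the minimal anti-diagonal mass of $\mathcal{T}$. Here, when $\alpha=\infty$, one sets $\alpha/(\alpha+1)=1$ and $\alpha+1=\infty$.
   Context: A permuton is a probability measure $\mu$ on $[0,1]^2$ with uniform marginals: $\mu([0,1]\times A)=\mu(A\times[0,1])=\lambda_1(A)$ for all measurable $A\subseteq[0,1]$, where $\lambda_1$ is Lebesgue measure. Minimal inversion: for points $(X_1,Y_1),\ldots,(X_n,Y_n)$ sampled from $\mu$, let $\mathrm{Inv}(i)=\{j:(X_i-X_j)(Y_i-Y_j)<0\}$ and $\mathcal{I}_n^\mu=\min\{|\mathrm{Inv}(i)|:1\le i\le n\}$. For a permutation $\sigma$ of $[k]$, $\mathrm{Inv}_\sigma(\ell)=\{m:(\ell-m)(\sigma(\ell)-\sigma(m))<0\}$. Generalized Rayleigh: $\mathrm{Rayleigh}(a,b)$ is the law of $R\ge0$ with $\mathbb{P}(R>t)=e^{-bt^a}$ for all $t\ge0$; $\mathrm{Rayleigh}(\infty,b)$ is the point mass at $b$. The symbol $\sim$ means that the ratio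 of the two sides tends to $1$. BL-smooth: $\mu$ is BL-smooth if there exists $0<\epsilon\le1/2$ such that $\mu$ admits a density $f$ on $[0,\epsilon]^2$, and there exist $\alpha_->0$ and a measurable function $\phi_-:[0,\infty)^2\to[0,\infty)$, bounded on every compact and strictly positive almost everywhere, such that $f(tx,ty)\sim t^{\alpha_--1}\phi_-(x,y)$ when $t\to0$. TR-smooth, with parameters $(\alpha_+,\phi_+)$: the image of $\mu$ under $(x,y)\mapsto(1-x,1-y)$ is BL-smooth with parameters $(\alpha_+,\phi_+)$. $\mu$ is $(\alpha,\phi)$-smooth if it is both BL-smooth and TR-smooth, with $f(tx,ty)+f(1-tx,1-ty)\sim t^{\alpha-1}\phi(x,y)$ when $t\to0$; equivalently, $\alpha=\min\{\alpha_-,\alpha_+\}$ and $\phi=\phi_-\mathbf{1}_{\alpha_-\le\alpha_+}+\phi_+\mathbf{1}_{\alpha_+\le\alpha_-}$. $\mu$ is corner-balanced if for every $0<\epsilon\le1/2$ there is $0<\rho<1$ with $\mu([0,\epsilon]\times[\rho,1])>0$ and $\mu([1-\epsilon,1]\times[0,\rho])>0$. $\mu$ is $(\alpha,\phi)$-standard if it is $(\alpha,\phi)$-smooth and corner-balanced. Tiling: a finite family $\mathcal{T}=\{S_1,\ldots,S_k\}$ of closed axis-parallel squares in $[0,1]^2$ with non-empty interior such that the horizontal side intervals cover $[0,1]$ and have pairwise disjoint interiors, and likewise for the vertical side intervals. Write $S_\ell=[x_\ell,x_\ell+\delta_\ell]\times[y_\ell,y_\ell+\delta_\ell]$ and order the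 squares so that $x_1<\cdots<x_k$. The permutation $\sigma_{\mathcal{T}}$ of $[k]$ is the one with $\sigma_{\mathcal{T}}(\ell)<\sigma_{\mathcal{T}}(m)\iff y_\ell<y_m$. The set of splittings is $D_{\mathcal{T}}=\{\ell\in[k]:\mathrm{Inv}_{\sigma_{\mathcal{T}}}(\ell)=\emptyset\}$. Let $L_{\mathcal{T}}(\ell)=\sum_{m\in\mathrm{Inv}_{\sigma_{\mathcal{T}}}(\ell)}\delta_m$ (empty sum $=0$); the minimal anti-diagonal mass is $M_{\mathcal{T}}=\min\{L_{\mathcal{T}}(\ell):\ell\in[k]\}$. Sub-permuton: for a closed square $S=[x_0,x_0+\delta]\times[y_0,y_0+\delta]\subseteq[0,1]^2$, $\delta>0$, a measure $\mu_S$ on $S$ whose two marginals are Lebesgue measure on the sides of $S$. Its rescaled permuton is $\tilde\mu_S(A)=\delta^{-1}\mu_S\big((x_0,y_0)+\delta A\big)$, $A\subseteq[0,1]^2$. $\mu_S$ is called $(\alpha,\phi)$-standard if $\tilde\mu_S$ is $(\alpha,\delta^\alpha\phi)$-standard. $\mu$ is $(\mathcal{T},\alpha,\phi)$-tile-standard if: (1) $\mathcal{T}=\{S_1,\ldots,S_k\}$ is a tiling with $\mu(S_1\cup\cdots\cup S_k)=1$; (2) for each $\ell$, the restriction $\mu_\ell$ of $\mu$ to $S_\ell$ is $(\alpha_\ell,\phi_\ell)$-standard for some $\alpha_\ell>0$ and $\phi_\ell$; (3) $\alpha=\min\{\alpha_\ell:\ell\in D_{\mathcal{T}}\}$ and $\phi=\sum_{\ell\in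 D_{\mathcal{T}}}\phi_\ell\mathbf{1}_{\alpha_\ell=\alpha}$, with $\alpha=\infty$ and $\phi=0$ if $D_{\mathcal{T}}=\emptyset$.
   Formalization: In BL/TR-smoothness, besides f(tx,ty) ~ t^(α-1) φ(x,y) at each point with φ>0, it is assumed that t^(1-α) f(tx,ty) stays bounded on each compact set (where φ>0) for small t; with only pointwise convergence the claim fails (mass on a cusp at the corner). *)

(* Defs.v *)
From HB Require Import structures.
From mathcomp Require Import all_boot all_order all_algebra all_fingroup.
From mathcomp Require Import all_classical all_reals all_analysis.

Set Implicit Arguments.
Unset Strict Implicit.
Unset Printing Implicit Defensive.

Import Order.TTheory GRing.Theory Num.Theory.
Import numFieldNormedType.Exports.

Local Open Scope classical_set_scope.
Local Open Scope ring_scope.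

(* The predicates on measures below are stated for set functions on the plane,
   so that they apply both to a probability [mu] and to the restrictions,
   images and rescalings of [mu]. *)

(* The real plane with its Borel sigma-algebra, presented as a product of the
   measurable spaces on which [lebesgue_measure] is defined. *)
Notation plane R := (measurableTypeR R * measurableTypeR R)%type.

Section permutons.
Context {R : realType}.
Implicit Types (m : set (R * R) -> \bar R) (phi f : R * R -> R).

Definition lebesgue2 : {measure set plane R -> \bar R} :=
  (@lebesgue_measure R \x @lebesgue_measure R)%E.

(* The case [A = `[0, 1]] gives [m] total mass one on the unit square. *)
Definition permuton m : Prop :=
  forall A : set R, measurable A -> A `<=` `[0, 1] ->
    m (`[0, 1] `*` A) = lebesgue_measure A /\
    m (A `*` `[0, 1]) = lebesgue_measure A.

Definition quadrant : set (R * R) := [set p | 0 <= p.1 /\ 0 <= p.2].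

Definition Delta : set (R * R) :=
  [set p | [/\ 0 <= p.1 <= 1, 0 <= p.2 <= 1 & p.1 + p.2 <= 1]].

Definition density_on m (D : set (R * R)) f : Prop :=
  [/\ measurable_fun (D : set (plane R)) f, (forall p, D p -> 0 <= f p) &
      forall A : set (plane R), measurable A -> A `<=` D ->
        m A = (\int[lebesgue2]_(p in A) (f p)%:E)%E].

(* [f(tx, ty) ~ t^(alpha - 1) phi(x, y)] as [t -> 0].  The ratio of the two
   sides tends to 1 at every point where it is defined; [phi] may vanish on a
   null set.  Convergence of the ratio separately along each ray does not
   control the mass of [f] near the origin: one can add to [f] the function
   [c / x] on the cusp [x^2 < y < 2 x^2], which every ray leaves as [t -> 0] but
   whose mass in [t Delta] is of order [t^2].  The asymptotics is therefore
   locally uniform in [(x, y)] to the extent expressed by the second clause,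
   which follows from uniform convergence of the ratio on compact sets when
   [phi] is locally bounded. *)
Definition corner_equiv f (alpha : R) phi : Prop :=
  (forall x y : R, 0 <= x -> 0 <= y -> 0 < phi (x, y) ->
     f (t * x, t * y) / (t `^ (alpha - 1) * phi (x, y)) @[t --> 0^'+]
       --> (1 : R)) /\
  (forall K : set (R * R), compact K -> K `<=` quadrant ->
     exists C : R, \forall t \near 0^'+, forall p, K p -> 0 < phi p ->
       f (t * p.1, t * p.2) <= C * t `^ (alpha - 1)).

Definition BL_smooth m (alpha : R) phi : Prop :=
  exists eps : R, exists f : R * R -> R,
    0 < eps <= 1 / 2 /\ density_on m (`[0, eps] `*` `[0, eps]) f /\
    0 < alpha /\
    measurable_fun (quadrant : set (plane R)) phi /\
    (forall p, quadrant p -> 0 <= phi p) /\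
    (forall K : set (R * R), compact K -> K `<=` quadrant ->
       exists C : R, forall p, K p -> phi p <= C) /\
    {ae lebesgue2, forall p, quadrant p -> 0 < phi p} /\
    corner_equiv f alpha phi.

Definition flip (p : R * R) : R * R := (1 - p.1, 1 - p.2).

Definition TR_smooth m (alpha : R) phi : Prop :=
  BL_smooth (pushforward m flip) alpha phi.

Definition smooth m (alpha : R) phi : Prop :=
  exists am ap : R, exists phim phip : R * R -> R,
    [/\ BL_smooth m am phim, TR_smooth m ap phip,
        alpha = Num.min am ap &
        forall p, quadrant p ->
          phi p = (if am <= ap then phim p else 0)
                + (if ap <= am then phip p else 0)].

Definition corner_balanced m : Prop :=
  forall eps : R, 0 < eps <= 1 / 2 -> exists2 rho : R, 0 < rho < 1 &
    (0 < m (`[0%R, eps] `*` `[rho, 1%R]))%E /\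
    (0 < m (`[(1 - eps)%R, 1%R] `*` `[0%R, rho]))%E.

Definition standard m (alpha : R) phi : Prop :=
  smooth m alpha phi /\ corner_balanced m.

End permutons.

Record square (R : realType) := Square { sqx : R; sqy : R; side : R }.

Section squares.
Context {R : realType}.
Implicit Types (S : square R) (m : set (R * R) -> \bar R).

Definition hside S : set R := `[sqx S, sqx S + side S].
Definition vside S : set R := `[sqy S, sqy S + side S].
Definition square_set S : set (R * R) := hside S `*` vside S.

Definition restriction m (D : set (R * R)) : set (R * R) -> \bar R :=
  fun A => m (A `&` D).

Definition rescaled m S : set (R * R) -> \bar R := fun A =>
  ((side S)^-1%:E *
   m ((fun p : R * R => (sqx S + side S * p.1, sqy S + side S * p.2)%R) @` A))%E.

Definition sub_standard m S (alpha : R) (phi : R * R -> R) : Prop :=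
  standard (rescaled m S) alpha (fun p => side S `^ alpha * phi p).

End squares.

Section tilings.
Context {R : realType} {k : nat}.
Variable T : 'I_k -> square R.

(* The squares are labelled from left to right. *)
Definition tiling : Prop :=
  [/\ forall l, 0 < side (T l) /\ square_set (T l) `<=` `[0, 1] `*` `[0, 1],
      forall l m : 'I_k, (l < m)%N -> sqx (T l) < sqx (T m),
      `[0, 1] `<=` \bigcup_l hside (T l) /\
        trivIset setT (fun l => interior (hside (T l))) &
      `[0, 1] `<=` \bigcup_l vside (T l) /\
        trivIset setT (fun l => interior (vside (T l)))].

(* For a tiling such a permutation exists and is unique, see
   [tiling_permP]. *)
Definition tiling_perm : 'S_k :=
  odflt 1%g [pick s : 'S_k | [forall l, forall m,
    (s l < s m)%N == (sqy (T l) < sqy (T m))]].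

Definition perm_inversions (s : 'S_k) (l : 'I_k) : {set 'I_k} :=
  [set m : 'I_k |
    ((l : nat)%:Z - (m : nat)%:Z) * ((s l : nat)%:Z - (s m : nat)%:Z) < 0]%SET.

Definition splittings : {set 'I_k} :=
  [set l | perm_inversions tiling_perm l == finset.set0]%SET.

Definition antidiag_mass (l : 'I_k) : R :=
  \sum_(m in perm_inversions tiling_perm l) side (T m).

(* A tiling has at least one square, so this is the minimum of a nonempty
   finite set. *)
Definition min_antidiag_mass : R := inf (range antidiag_mass).

(* The neutral element [+oo] of the minimum is the value of [alpha] when there
   is no splitting; the sum defining [phi] is then empty. *)
Definition tile_standard (alpha : \bar R) (phi : R * R -> R)
    (mu : set (R * R) -> \bar R) : Prop :=
  [/\ tiling, mu (\bigcup_l square_set (T l)) = 1%E &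
    exists al : 'I_k -> R, exists ph : 'I_k -> R * R -> R,
    [/\ forall l, 0 < al l /\
          sub_standard (restriction mu (square_set (T l))) (T l) (al l) (ph l),
        alpha = \big[Order.min/+oo%E]_(l in splittings) (al l)%:E &
        forall p, quadrant p ->
          phi p = \sum_(l in splittings | (al l)%:E == alpha) ph l p]].

Lemma tiling_sqy_inj : tiling -> injective (fun l => sqy (T l)).
Proof.
move=> [hT _ _ [_ tv]] l m /= e.
apply: (tv l m I I); rewrite /vside !interior_itv_bnd /= e.
exists (sqy (T m) + Num.min (side (T l)) (side (T m)) / 2).
have [pl _] := hT l; have [pm _] := hT m.
have h : 0 < Num.min (side (T l)) (side (T m)) by rewrite lt_min pl pm.
have h2 : Num.min (side (T l)) (side (T m)) / 2
    < Num.min (side (T l)) (side (T m)).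
  by rewrite ltr_pdivrMr// ltr_pMr// ltr1n.
by split; rewrite /= in_itv /= ltrDl divr_gt0//= ltrD2l;
  apply: (lt_le_trans h2); rewrite ge_min lexx ?orbT.
Qed.

Lemma tiling_permP : tiling -> forall l m : 'I_k,
  (tiling_perm l < tiling_perm m)%N = (sqy (T l) < sqy (T m)).
Proof.
move=> hT; rewrite /tiling_perm; case: pickP => [s /forallP hs l m|no].
  by have /forallP/(_ m)/eqP := hs l.
pose A l := [set m : 'I_k | sqy (T m) < sqy (T l)]%SET.
have rkP l : (#|A l| < k)%N.
  rewrite -[X in (_ < X)%N]card_ord -cardsT; apply: proper_card.
  by apply/properP; split; [exact: finset.subsetT | exists l; rewrite ?inE ?ltxx].
pose rk l := Ordinal (rkP l).
have rklt l m : sqy (T l) < sqy (T m) -> (rk l < rk m)%N.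
  move=> lm; apply: proper_card; apply/properP; split.
    by apply/fintype.subsetP => i; rewrite !inE => /lt_trans; exact.
  by exists l; rewrite !inE ?lm ?ltxx.
have rkE l m : (rk l < rk m)%N = (sqy (T l) < sqy (T m)).
  case: (ltP (sqy (T l))) => [/rklt//|].
  rewrite le_eqVlt => /orP[/eqP/(tiling_sqy_inj hT) ->|/rklt/ltnW].
    by rewrite ltnn.
  by rewrite leqNgt => /negbTE.
have rkI : injective rk.
  move=> l m e; apply: (tiling_sqy_inj hT) => /=; apply/eqP.
  by rewrite eq_le !leNgt -!rkE e ltnn.
have := no (perm rkI) => /forallP; case => l; apply/forallP => m.
by rewrite !permE; apply/eqP/rkE.
Qed.

End tilings.

Section sampling.
Context {R : realType}.

(* Mutual independence: the subfamilies are obtained by taking some of the sets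
   [A i] equal to the whole plane. *)
Definition iid_sample d (Omega : measurableType d) (P : probability Omega R)
    (mu : set (R * R) -> \bar R) n (Z : 'I_n -> {RV P >-> plane R}) : Prop :=
  (forall i (A : set (plane R)), measurable A -> P (Z i @^-1` A) = mu A) /\
  (forall A : 'I_n -> set (plane R), (forall i, measurable (A i)) ->
     P (\bigcap_i (Z i @^-1` A i)) = (\prod_(i < n) P (Z i @^-1` A i))%E).

Definition inversions n (z : 'I_n -> R * R) (i : 'I_n) : {set 'I_n} :=
  [set j | ((z i).1 - (z j).1) * ((z i).2 - (z j).2) < 0]%SET.

(* Each cardinal is at most [n], so the neutral element [n] does not affect the
   minimum when [0 < n]. *)
Definition min_inversion n (z : 'I_n -> R * R) : nat :=
  \big[minn/n]_(i < n) #|inversions z i|.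

Definition rayleigh (a : \bar R) (b : R) (nu : set R -> \bar R) : Prop :=
  match a with
  | a'%:E => nu `[0, +oo[%classic = 1%E /\
      forall t : R, 0 <= t -> nu `]t, +oo[%classic = (expR (- (b * t `^ a')))%:E
  | +oo%E => forall A : set R, measurable A -> nu A = \d_b A
  | -oo%E => False
  end.

(* Convergence of the distribution functions at the continuity points of the
   limit; the variables [X n] may live on different probability spaces. *)
Definition cvg_in_distribution (d : nat -> measure_display)
    (Omega : forall n, measurableType (d n))
    (P : forall n, probability (Omega n) R) (X : forall n, Omega n -> R)
    (nu : set R -> \bar R) : Prop :=
  forall t : R, {for t, continuous (fun s : R => nu `]-oo, s]%classic)} ->
    P n [set w | X n w <= t] @[n --> \oo] --> nu `]-oo, t]%classic.

(* [alpha / (alpha + 1)], read as 1 when [alpha = +oo]. *)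
Definition rate (alpha : \bar R) : R :=
  if alpha is a%:E then a / (a + 1) else 1.

End sampling.

(* Main.v *)
(** Put [r_n = n ^ (- 1 / (alpha + 1))]. A sample point lying in a splitting square
    at distances [x], [y] from its bottom-left (or top-right) corner, with [x], [y]
    of order [r_n], is inverted with the points of the strips of widths [x] and [y]
    along the two sides, up to those in the corner itself. By Chebyshev's inequality
    for finitely many strips there are about [n (x + y)] of them, because the corner
    carries a negligible share of the strips. All the other points are inverted with
    a fixed positive proportion of the sample: with a whole tile when their own tile
    is not a splitting, and by corner balance otherwise. Hence the minimal inversion
    is at most [t n r_n] exactly when some point lies in a triangle of size [t r_n]
    at one of the corners, up to small probability and to an arbitrarily small change
    of [t]. If [E] is the union of these triangles, this event has probability
    [1 - (1 - mu E) ^ n], and [n mu E] tends to [t ^ (alpha + 1)] times the integral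
    of [phi] over [Delta] by scaling and dominated convergence. Without splittings,
    every point of the [l]-th tile has at least about [n L(l)] inversions, and the
    points close to its corner have about that many. *)

Require Import Defs.
From HB Require Import structures.
From mathcomp Require Import all_boot all_order all_algebra all_fingroup.
From mathcomp Require Import all_classical all_reals all_analysis.
From mathcomp Require Import measurable_realfun ring lra.

Set Implicit Arguments.
Unset Strict Implicit.
Unset Printing Implicit Defensive.

Import Order.TTheory GRing.Theory Num.Theory.
Import numFieldNormedType.Exports.

Local Open Scope classical_set_scope.
Local Open Scope ring_scope.

(** * Counting sample points *)

(** The inversion count of a sample point depends on where that point lies, so the estimates have to
    hold for all positions at once. They are stated as events on which every point [p] of the plane
    has a certain property: strip widths are rounded to a grid of step [h r_n], so that finitely
    many strips serve all [p], and the passage from strips to [p] is deterministic. The scale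
    satisfies [n r_n ^ (alpha + 1) = 1], which keeps the expected number of points in a corner
    triangle bounded, whereas [n r_n] tends to infinity; hence a strip of width of order [r_n] has a
    count of variance of order [n r_n], negligible against [(n r_n) ^ 2]. The delicate direction is
    the lower bound, because a point near a corner need not be inverted with the points of its
    strips that lie near the same corner. Removing a corner box of fixed size [eta] makes the
    inversions automatic and the two strips disjoint, at the price of a small fraction [kappa] of
    their width. Corners may have different exponents; only those equal to the minimum survive in
    the limit. *)

Section counts.
Context {R : realType} {d : measure_display} {Omega : measurableType d}.
Variables (P : probability Omega R) (mu : probability (plane R) R) (n : nat).
Variable Z : 'I_n -> {RV P >-> plane R}.

Definition count_in (A : set (plane R)) (w : Omega) : R :=
  \sum_(i < n) \1_A (Z i w).

Lemma measurable_preim (A : set (plane R)) i :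
  measurable A -> measurable (Z i @^-1` A).
Proof. by move=> mA; rewrite -[X in measurable X]setTI; exact: measurable_funPT. Qed.

Lemma measurable_indic_preim (A : set (plane R)) i :
  measurable A -> measurable_fun setT (fun w => \1_A (Z i w) : R).
Proof.
move=> mA.
have -> : (fun w => \1_A (Z i w) : R) = \1_(Z i @^-1` A).
  by apply/funext => w; rewrite !indicE /= /in_mem/= .
by apply: measurable_indic; exact: measurable_preim.
Qed.

Lemma measurable_count_in (A : set (plane R)) :
  measurable A -> measurable_fun setT (count_in A).
Proof.
move=> mA; rewrite /count_in; apply: measurable_sum => i.
exact: measurable_indic_preim.
Qed.

Hypothesis iidZ : iid_sample mu Z.

Lemma prob_preim (A : set (plane R)) i : measurable A -> P (Z i @^-1` A) = mu A.
Proof. by move=> mA; exact: iidZ.1. Qed.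

Lemma prob_all_in (A : set (plane R)) : measurable A ->
  P (\bigcap_i (Z i @^-1` A)) = ((fine (mu A)) ^+ n)%:E.
Proof.
move=> mA; rewrite (iidZ.2 (fun=> A))//.
rewrite (eq_bigr (fun=> mu A)); last by move=> i _; exact: prob_preim.
rewrite -(fineK (fin_num_measure mu _ mA)) prodEFin prodr_const card_ord.
by [].
Qed.

Lemma prob_preimI (A : set (plane R)) i j : measurable A -> i != j ->
  P ((Z i @^-1` A) `&` (Z j @^-1` A)) = (mu A * mu A)%E.
Proof.
move=> mA ij.
pose B l : set (plane R) := if (l == i) || (l == j) then A else setT.
have mB l : measurable (B l) by rewrite /B; case: ifP.
have -> : (Z i @^-1` A) `&` (Z j @^-1` A) = \bigcap_l (Z l @^-1` B l).
  apply/seteqP; split => w /=.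
    by move=> [wi wj] l _; rewrite /B/=; case: ifP => // /orP[]/eqP ->.
  by move=> h; split; [have := h i I|have := h j I]; rewrite /= /B eqxx ?orbT.
rewrite iidZ.2//.
rewrite (bigD1 i)//= (bigD1 j) 1?eq_sym//= big1 => [|l /andP[li lj]].
  by rewrite mule1 !prob_preim// /B !eqxx orbT.
by rewrite prob_preim// /B (negbTE li) (negbTE lj)/= probability_setT.
Qed.

Lemma integral_count_in (A : set (plane R)) : measurable A ->
  (\int[P]_w (count_in A w)%:E = n%:R%:E * mu A)%E.
Proof.
move=> mA.
have h i : (fun w => (\1_A (Z i w))%:E) = (fun w => (\1_(Z i @^-1` A) w)%:E) :> (Omega -> \bar R).
  by apply/funext => w; rewrite !indicE /= /in_mem/= .
under eq_integral do rewrite -sumEFin.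
rewrite ge0_integral_sum//.
2: by move=> i; apply/measurable_EFinP; exact: measurable_indic_preim.
rewrite (eq_bigr (fun=> mu A)); last first.
  move=> i _; rewrite h integral_indic//; last exact: measurable_preim.
  by rewrite setIT; exact: prob_preim.
by rewrite -(fineK (fin_num_measure mu _ mA)) sumEFin sumr_const card_ord -EFinM mulr_natl.
Qed.

(** The square is a sum over pairs of indices: the diagonal gives [n p], and the [n (n - 1)]
    independent pairs are bounded by [n ^ 2] of them, which suffices for a variance at most
    [n p]. *)
Lemma integral_count_in_sqr (A : set (plane R)) : measurable A ->
  (\int[P]_w (count_in A w ^+ 2)%:E
     <= (n%:R * fine (mu A) + (n%:R * fine (mu A)) ^+ 2)%:E)%E.
Proof.
move=> mA; set p := fine (mu A).
have pE : mu A = p%:E by rewrite fineK ?fin_num_measure.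
have h w : (count_in A w ^+ 2)%:E =
    (\sum_(i < n) \sum_(j < n) (\1_((Z i @^-1` A) `&` (Z j @^-1` A)) w)%:E)%E.
  rewrite expr2 {1}/count_in mulr_suml -sumEFin; apply: eq_bigr => i _.
  rewrite /count_in mulr_sumr -sumEFin; apply: eq_bigr => j _.
  by rewrite indicI.
under eq_integral do rewrite h.
have mI i j := measurableI _ _ (measurable_preim i mA) (measurable_preim j mA).
rewrite ge0_integral_sum//.
2: move=> i; apply: emeasurable_sum => j; apply/measurable_EFinP.
2: exact: measurable_indic.
2: by move=> i w _; apply: sume_ge0 => j _; rewrite lee_fin.
have hi i : (\int[P]_x (\sum_(j < n)
    (\1_((Z i @^-1` A) `&` (Z j @^-1` A)) x)%:E) <=
    (p + n%:R * p ^+ 2)%:E)%E.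
  rewrite ge0_integral_sum//.
  2: by move=> j; apply/measurable_EFinP; exact: measurable_indic.
  rewrite (bigD1 i)//= integral_indic; [|by []|exact: mI].
  rewrite setIT setIid EFinD; apply: leeD.
    by rewrite -pE -(prob_preim i mA); exact: lexx.
  rewrite (eq_bigr (fun=> (p ^+ 2)%:E)); last first.
    move=> j ji; rewrite integral_indic; [|by []|exact: mI].
    by rewrite setIT expr2 EFinM -pE; apply: prob_preimI => //; rewrite eq_sym.
  rewrite sumEFin lee_fin sumr_const -[leLHS]mulr_natl ler_wpM2r ?sqr_ge0//.
  by rewrite ler_nat -[leqRHS](card_ord n) max_card.
apply: (@le_trans _ _ (\sum_(i < n) (p + n%:R * p ^+ 2)%:E)%E).
  by apply: lee_sum => i _; exact: hi.
rewrite sumEFin sumr_const card_ord lee_fin -mulr_natl.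
by rewrite le_eqVlt; apply/orP; left; apply/eqP; ring.
Qed.

Lemma integral_count_in_dev (A : set (plane R)) : measurable A ->
  (\int[P]_w ((count_in A w - n%:R * fine (mu A)) ^+ 2)%:E
     <= (n%:R * fine (mu A))%:E)%E.
Proof.
move=> mA; set p := fine (mu A).
have pE : mu A = p%:E by rewrite fineK ?fin_num_measure.
have p0 : 0 <= p by rewrite fine_ge0.
have mN := measurable_count_in mA.
have N0 w : 0 <= count_in A w by apply: sumr_ge0.
have := integral_count_in_sqr mA; rewrite -/p => h2.
have md : measurable_fun setT (fun w => (count_in A w - n%:R * p) ^+ 2).
  by apply: measurable_funX; apply: measurable_funB.
(* The square is expanded with the cross term moved to the other side, so that all integrands are
   nonnegative and no integrability has to be checked. *)
have : (\int[P]_w ((count_in A w - n%:R * p) ^+ 2)%:E +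
       (2 * (n%:R * p))%:E * \int[P]_w (count_in A w)%:E =
       \int[P]_w (count_in A w ^+ 2)%:E + ((n%:R * p) ^+ 2)%:E)%E.
  have np0 : 0 <= 2 * (n%:R * p) by rewrite !mulr_ge0.
  rewrite -ge0_integralZl_EFin//; last 2 first.
  - by move=> w _; rewrite lee_fin.
  - exact/measurable_EFinP.
  rewrite -ge0_integralD//; last 3 first.
  - exact/measurable_EFinP.
  - by move=> w _; rewrite mule_ge0// lee_fin.
  - by apply: measurable_funeM; exact/measurable_EFinP.
  have -> : ((n%:R * p) ^+ 2)%:E = (\int[P]_w (cst ((n%:R * p) ^+ 2)%:E w))%E.
    rewrite integral_cst//.
    by rewrite -[LHS]mule1; congr (_ * _)%E; rewrite -(@probability_setT _ _ _ P).
  rewrite -ge0_integralD//; last 2 first.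
  - by apply/measurable_EFinP; exact: measurable_funX.
  - by move=> w _; rewrite lee_fin sqr_ge0.
  by apply: eq_integral => w _; rewrite /= -!EFinM -!EFinD; congr EFin; ring.
  by move=> w _; rewrite lee_fin sqr_ge0.
  by move=> w _; rewrite lee_fin sqr_ge0.
rewrite integral_count_in// pE -!EFinM => h1.
have : (\int[P]_w ((count_in A w - n%:R * p) ^+ 2)%:E
    + (2 * (n%:R * p) * (n%:R * p))%:E <=
    (n%:R * p)%:E + (2 * (n%:R * p) * (n%:R * p))%:E)%E.
  rewrite h1 (le_trans (leeD h2 (lexx _)))// -!EFinD lee_fin.
  by rewrite le_eqVlt; apply/orP; left; apply/eqP; ring.
by rewrite leeD2rE.
Qed.

Lemma count_in_chebyshev (A : set (plane R)) (lam : R) :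
  measurable A -> 0 < lam ->
  (P [set w | (lam <= `|count_in A w - n%:R * fine (mu A)|)%R]
     <= (n%:R * fine (mu A) / lam ^+ 2)%:E)%E.
Proof.
move=> mA lam0; set p := fine (mu A); set S := [set w | _].
have mN := measurable_count_in mA.
have mS : measurable S.
  have -> : S = setT `&` (fun w => `|count_in A w - n%:R * p|) @^-1` `[lam, +oo[.
    by rewrite setTI; apply/seteqP; split => w; rewrite /S/= in_itv/= andbT.
  apply: measurableT_comp => //; exact: measurable_funB.
have l2 : 0 < lam ^+ 2 by rewrite exprn_gt0.
have := integral_count_in_dev mA; rewrite -/p => h.
rewrite EFinM lee_pdivlMr// muleC; apply: le_trans h.
have -> : ((lam ^+ 2)%:E * P S = \int[P]_w ((lam ^+ 2)%:E * (\1_S w)%:E))%E.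
  rewrite ge0_integralZl_EFin ?ltW// ?integral_indic ?setIT//.
  - by apply/measurable_EFinP; exact: measurable_indic.
apply: ge0_le_integral => //.
- by move=> w _; rewrite -EFinM lee_fin mulr_ge0// ltW.
- by apply: measurable_funeM; apply/measurable_EFinP; exact: measurable_indic.
- apply/measurable_EFinP; apply: measurable_funX; exact: measurable_funB.
move=> w _; rewrite -EFinM lee_fin indicE; case: (boolP (w \in S)); rewrite ?inE => Sw.
  by rewrite mulr1 -[leRHS]real_normK ?num_real// lerXn2r ?nnegrE// ltW.
by rewrite mulr0 sqr_ge0.
Qed.

End counts.

(** * Events of asymptotically full probability *)

Section whp.
Context {R : realType} {d : nat -> measure_display}
  {Omega : forall n, measurableType (d n)}.
Variable P : forall n, probability (Omega n) R.

(* The property may fail outside of its measurable part: only an exceptional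
   set covering its complement has to be measurable. *)
Definition whp (Q : forall n, Omega n -> Prop) : Prop :=
  exists B : forall n, set (Omega n), [/\ forall n, measurable (B n),
    forall n w, ~ B n w -> Q n w & P n (B n) @[n --> \oo] --> 0%E].

Lemma whp_near (Q : forall n, Omega n -> Prop) :
  (\forall n \near \oo, forall w, Q n w) -> whp Q.
Proof.
move=> [N _ hN].
exists (fun n => if (n < N)%N then setT else set0); split.
- by move=> n; case: ifP.
- move=> n w; case: ltnP => [_ /(_ I)//|Nn _]; exact: hN.
apply: cvg_near_cst; exists N => // n /= Nn.
by rewrite ltnNge Nn/= measure0.
Qed.

Lemma whpI (Q1 Q2 : forall n, Omega n -> Prop) :
  whp Q1 -> whp Q2 -> whp (fun n w => Q1 n w /\ Q2 n w).
Proof.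
move=> [B1 [m1 h1 c1]] [B2 [m2 h2 c2]].
exists (fun n => B1 n `|` B2 n); split.
- by move=> n; exact: measurableU.
- by move=> n w /not_orP[/h1 ? /h2].
apply: (@squeeze_cvge _ _ _ _ (cst 0%E) _ (fun n => (P n (B1 n) + P n (B2 n))%E)).
- apply: nearW => n; rewrite measure_ge0/=; exact: measureU2.
- exact: cvg_cst.
- by rewrite -[X in _ --> X]adde0; apply: cvgeD.
Qed.

Lemma whpS (Q1 Q2 : forall n, Omega n -> Prop) :
  whp Q1 -> (\forall n \near \oo, forall w, Q1 n w -> Q2 n w) -> whp Q2.
Proof.
move=> h1 /whp_near h2; have [B [mB hB cB]] := whpI h1 h2.
by exists B; split=> // n w /hB[q1]; exact.
Qed.

Lemma whp_forall (I : finType) (Q : I -> forall n, Omega n -> Prop) :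
  (forall i, whp (Q i)) -> whp (fun n w => forall i, Q i n w).
Proof.
move=> h; have : whp (fun n w => forall i, i \in enum I -> Q i n w).
  elim: (enum I) => [|i s IH]; first by apply: whp_near; apply: nearW.
  apply: whpS (whpI (h i) IH) _; apply: nearW => n w [q1 q2] j.
  by rewrite inE => /orP[/eqP->|/q2].
by move=> /whpS; apply; apply: nearW => n w q i; apply: q; rewrite mem_enum.
Qed.

(** Deterministic implications valid off an exceptional set enter the limit theorem through this
    comparison of probabilities. *)
Lemma whp_le (E F : forall n, set (Omega n)) :
  (forall n, measurable (E n)) -> (forall n, measurable (F n)) ->
  whp (fun n w => E n w -> F n w) ->
  forall e : R, 0 < e -> \forall n \near \oo, (P n (E n) <= P n (F n) + e%:E)%E.
Proof.
move=> mE mF [B [mB hB cB]] e e0.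
have : \forall n \near \oo, (P n (B n) < e%:E)%E.
  have := cB [set x | (x < e%:E)%E]; apply.
    by apply: open_nbhs_nbhs; split; [exact: open_ereal_lt_ereal|].
apply: filterS => n Bn.
apply: (@le_trans _ _ (P n (F n `|` B n))).
  apply: le_measure; rewrite ?inE//; first exact: measurableU.
  by move=> w Ew; case: (pselect (B n w)) => [|/hB/(_ Ew)]; [right|left].
by apply: le_trans (measureU2 _ _ _) _ => //; rewrite leeD2l// ltW.
Qed.

Variables (mu : probability (plane R) R) (Z : forall n, 'I_n -> {RV (P n) >-> plane R}).
Arguments Z : clear implicits.
Hypothesis iidZ : forall n, iid_sample mu (Z n).

Lemma whp_count (A : nat -> set (plane R)) (lam : nat -> R) :
  (forall n, measurable (A n)) -> (\forall n \near \oo, 0 < lam n) ->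
  n%:R * fine (mu (A n)) / lam n ^+ 2 @[n --> \oo] --> (0 : R) ->
  whp (fun n w => `|count_in (Z n) (A n) w - n%:R * fine (mu (A n))| < lam n).
Proof.
move=> mA lam0 c.
exists (fun n => [set w | (lam n <= `|count_in (Z n) (A n) w - n%:R * fine (mu (A n))|)%R]).
split.
- move=> n; have mN := measurable_count_in (Z n) (mA n).
  rewrite (_ : [set w | _] = setT `&`
    (fun w => `|count_in (Z n) (A n) w - n%:R * fine (mu (A n))|) @^-1` `[lam n, +oo[).
    by apply: measurableT_comp => //; exact: measurable_funB.
  by rewrite setTI; apply/seteqP; split => w; rewrite /=in_itv/= andbT.
- by move=> n w /=/negP; rewrite -ltNge.
apply: (@squeeze_cvge _ _ _ _ (cst 0%E) _ (fun n => (n%:R * fine (mu (A n)) / lam n ^+ 2)%:E)).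
- by apply: filterS lam0 => n l0; rewrite measure_ge0/=; exact: count_in_chebyshev.
- exact: cvg_cst.
- by apply/cvg_EFin; [exact: nearW|].
Qed.

Lemma whp_all_in (A : set (plane R)) : measurable A -> mu A = 1%E ->
  whp (fun n w => forall i : 'I_n, A (Z n i w)).
Proof.
move=> mA A1; exists (fun n => ~` \bigcap_(i in [set: 'I_n]) (Z n i @^-1` A)).
have mB n : measurable (\bigcap_(i in [set: 'I_n]) (Z n i @^-1` A)).
  by apply: fin_bigcap_measurable => // i _; exact: measurable_preim.
split.
- by move=> n; exact: measurableC.
- by move=> n w /contrapT h i; exact: h.
apply: cvg_near_cst; apply: nearW => n.
rewrite probability_setC// (prob_all_in (iidZ n) mA).
by rewrite A1/= expr1n subee.
Qed.

End whp.

(** * Scaling at a corner *)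

Section scaling.
Context {R : realType}.

Definition scale (t : R) (p : plane R) : plane R := (t * p.1, t * p.2).

Lemma measurable_scale t : measurable_fun setT (scale t).
Proof.
apply: measurable_fun_pair; apply: measurable_funM => //.
Qed.

Lemma measurable_mulr (t : R) :
  measurable_fun setT ( *%R t : measurableTypeR R -> measurableTypeR R).
Proof. exact: measurable_funM. Qed.

(** The right-hand side is a measure in [A] that agrees with Lebesgue measure on the intervals []a,
    b]], hence everywhere. *)
Lemma lebesgue_measure_scale (t : R) (A : set R) : 0 < t -> measurable A ->
  lebesgue_measure A = (t%:E * lebesgue_measure ( *%R t @^-1` A))%E.
Proof.
move=> t0 mA.
pose m' : {measure set (measurableTypeR R) -> \bar R} := mscale (NngNum (ltW t0))
  (measure_function_pushforward__canonical__measure_function_Measure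
     (@lebesgue_measure R) (measurable_mulr t)).
rewrite (lebesgue_measure_unique (mu := m'))//.
move=> _ [[a b] _ <-]; rewrite /= /m' /mscale/= /pushforward.
have -> : *%R t @^-1` `]a, b] = `]a / t, b / t]%classic.
  apply/seteqP; split => x /=;
  by rewrite !in_itv/= ltr_pdivrMr// ler_pdivlMr// ![x * t]mulrC.
rewrite !lebesgue_measure_itv/= !lte_fin ltr_pM2r ?invr_gt0//.
case: ifPn => ab; last by rewrite mule0.
rewrite -!EFinD -EFinM -mulrBl mulrCA divff ?mulr1// gt_eqF//.
Qed.

Definition lebesgue2_pushforward t : {measure set (plane R) -> \bar R} :=
  measure_function_pushforward__canonical__measure_function_Measure
    (@lebesgue2 R) (measurable_scale t).

Lemma lebesgue2E (A B : set R) : measurable A -> measurable B ->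
  lebesgue2 (A `*` B) = (lebesgue_measure A * lebesgue_measure B)%E.
Proof. by move=> mA mB; exact: product_measure1E. Qed.

Lemma lebesgue2_scale (t : R) (A : set (plane R)) : 0 < t -> measurable A ->
  lebesgue2 A = ((t ^+ 2)%:E * lebesgue2 (scale t @^-1` A))%E.
Proof.
move=> t0 mA.
have t20 : 0 <= t ^+ 2 by rewrite sqr_ge0.
pose m' : {measure set (plane R) -> \bar R} :=
  mscale (NngNum t20) (lebesgue2_pushforward t).
have H := @product_measure_unique _ _ _ _ R (@lebesgue_measure R) (@lebesgue_measure R) m'.
apply: (H _ A mA) => B C mB mC; transitivity ((t ^+ 2)%:E * lebesgue2 (( *%R t @^-1` B) `*` ( *%R t @^-1` C)))%E => //.
rewrite lebesgue2E//; last 2 first.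
- by rewrite -[X in measurable X]setTI; exact: measurable_mulr.
- by rewrite -[X in measurable X]setTI; exact: measurable_mulr.
transitivity ((t%:E * lebesgue_measure ( *%R t @^-1` B)) *
    (t%:E * lebesgue_measure ( *%R t @^-1` C)))%E.
  by rewrite expr2 EFinM muleACA.
by congr (_ * _)%E; apply/esym; exact: lebesgue_measure_scale.
Qed.

(** Lebesgue measure is [t ^+ 2] times its own image under [scale t], and integrating against an
    image measure amounts to composing with the map. *)
Lemma ge0_integral_scale (t : R) (A : set (plane R)) (f : R * R -> R) :
  0 < t -> measurable A -> measurable_fun (A : set (plane R)) f ->
  (forall p, A p -> 0 <= f p) ->
  (\int[lebesgue2]_(p in A) (f p)%:E =
   (t ^+ 2)%:E * \int[lebesgue2]_(p in scale t @^-1` A) (f (scale t p))%:E)%E.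
Proof.
move=> t0 mA mf f0.
have [k kE] : exists k : {nonneg R}, k%:num = t ^+ 2.
  by exists (NngNum (sqr_ge0 t)).
have mf' : measurable_fun A (EFin \o f : plane R -> \bar R).
  exact/measurable_EFinP.
pose pf := lebesgue2_pushforward t.
pose m' : {measure set (plane R) -> \bar R} := mscale k pf.
rewrite (@eq_measure_integral _ _ _ A m' lebesgue2); last first.
  by move=> B mB _; rewrite (lebesgue2_scale t0 mB) -kE.
have E1 : (\int[m']_(p in A) (EFin \o f) p = k%:num%:E * \int[pf]_(p in A) (EFin \o f) p)%E.
  by apply: ge0_integral_mscale => // p /f0; rewrite lee_fin.
transitivity (k%:num%:E * \int[pf]_(p in A) (EFin \o f) p)%E.
  exact: E1.
rewrite kE.
have E2 : (\int[pf]_(p in A) (EFin \o f) p =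
    \int[lebesgue2]_(p in scale t @^-1` A) ((EFin \o f) \o scale t) p)%E.
  2: exact: (congr1 (fun x => (t ^+ 2)%:E * x)%E E2).
apply: (ge0_integral_pushforward (measurable_scale t)) => //.
by move=> p; rewrite inE => /f0; rewrite lee_fin.
Qed.

End scaling.

(** * Mass of small dilates at a smooth corner *)

Section corner_density.
Context {R : realType}.

Definition unit_square : set (plane R) := `[0, 1] `*` `[0, 1].

(** For [t > 0] this is the image of [A] under [p -> t p]; as a preimage it is measurable at
    once. *)
Definition dilate (t : R) (A : set (plane R)) : set (plane R) :=
  scale t^-1 @^-1` A.

Lemma measurable_scaleI (t : R) (A : set (plane R)) :
  measurable A -> measurable (scale t @^-1` A).
Proof. by move=> mA; rewrite -[X in measurable X]setTI; exact: measurable_scale. Qed.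

Lemma scale_dilate (t : R) (A : set (plane R)) : 0 < t ->
  scale t @^-1` dilate t A = A.
Proof.
move=> t0; rewrite /dilate -comp_preimage.
rewrite (_ : _ \o _ = id) ?preimage_id//; apply/funext => -[x y].
by rewrite /scale/= !mulKf// gt_eqF.
Qed.

Lemma near0_rightP (Q : R -> Prop) : (\forall t \near 0^'+, Q t) ->
  exists2 e : R, 0 < e & forall t, 0 < t < e -> Q t.
Proof.
move=> [e /= e0 h]; exists e => // t /andP[t0 te]; apply: h => //=.
by rewrite sub0r normrN gtr0_norm.
Qed.

Lemma lebesgue2_box (s t : R) : 0 <= s -> 0 <= t ->
  lebesgue2 (`[0, s] `*` `[0, t]) = (s * t)%:E.
Proof.
have h (u : R) : 0 <= u -> lebesgue_measure (`[0, u] : set R) = u%:E.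
  move=> u0; rewrite lebesgue_measure_itv/= lte_fin oppr0 adde0.
  by case: ltgtP u0 => // <-.
by move=> /h hs /h ht; apply: etrans (lebesgue2E _ _) _ => //; rewrite [LHS](f_equal2 mule hs ht).
Qed.

Lemma lebesgue2_unit_le (A : set (plane R)) : measurable A -> A `<=` unit_square ->
  (lebesgue2 A <= 1)%E.
Proof.
move=> mA A1; have mU : measurable unit_square by exact: measurableX.
apply: (@le_trans _ _ (lebesgue2 unit_square)).
  by apply: le_measure; rewrite ?inE.
by rewrite /unit_square lebesgue2_box// mulr1.
Qed.

Variables (m : set (R * R) -> \bar R) (a : R) (phi : R * R -> R).
Hypothesis hBL : BL_smooth m a phi.

Lemma BL_smooth_measurable (A : set (plane R)) : measurable A -> A `<=` unit_square ->
  measurable_fun A (phi : plane R -> R).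
Proof.
case: hBL => [eps [f [_ [_ [_ [mphi _]]]]]] mA A1.
apply: measurable_funS mphi => //.
  rewrite (_ : quadrant = `[0, +oo[ `*` `[0, +oo[); first exact: measurableX.
  by apply/seteqP; split => -[x y]; rewrite /quadrant/= !in_itv/= !andbT.
by move=> p /A1 [/=]; rewrite !in_itv/= => /andP[? _] /andP[? _].
Qed.

(** The asymptotics and the bound in [corner_equiv] are available only where [phi] is positive; this
    turns them into almost everywhere statements. *)
Lemma BL_smooth_ae (Q : plane R -> Prop) :
  (forall p, (quadrant p -> 0 < phi p) -> Q p) -> {ae lebesgue2, forall p, Q p}.
Proof.
case: hBL => [_ [_ [_ [_ [_ [_ [_ [_ [[N [mN N0 hN]] _]]]]]]]]] h.
by exists N; split=> // p; apply: contra_notP => Np; apply: h; apply: contra_notP Np => /hN.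
Qed.

Lemma BL_smooth_ge0 (p : R * R) : quadrant p -> 0 <= phi p.
Proof. by case: hBL => [eps [f [_ [_ [_ [_ [h _]]]]]]]; exact: h. Qed.

Lemma unit_square_quadrant : unit_square `<=` @quadrant R.
Proof. by move=> p [/=]; rewrite !in_itv/= => /andP[? _] /andP[? _]. Qed.

Lemma compact_unit_square : compact (unit_square : set (R * R)).
Proof. by apply: compact_setX; exact: segment_compact. Qed.

Lemma BL_smooth_integral_fin (A : set (plane R)) : measurable A -> A `<=` unit_square ->
  (\int[lebesgue2]_(p in A) (phi p)%:E < +oo)%E.
Proof.
move=> mA A1; have mphi := BL_smooth_measurable mA A1.
case: hBL => [eps [f [_ [_ [_ [_ [phi0 [bphi _]]]]]]]].
have [C hC] := bphi _ compact_unit_square unit_square_quadrant.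
apply: (@le_lt_trans _ _ (\int[lebesgue2]_(p in A) (cst (Num.max C 0)%:E p))%E).
  apply: ge0_le_integral => //.
  - by move=> p /A1/unit_square_quadrant/phi0; rewrite lee_fin.
  - exact/measurable_EFinP.
  - by move=> p /A1/hC; rewrite lee_fin le_max => ->.
rewrite integral_cst//; apply: lte_mul_pinfty.
- by rewrite lee_fin le_max lexx orbT.
- by [].
- by apply: (le_lt_trans (lebesgue2_unit_le mA A1)); rewrite ltry.
Qed.

(** The change of variables moves the dependence on [t] from the domain to the integrand, where a
    bound or a limit can be taken. *)
Lemma BL_smooth_dilate : exists eps : R, exists f : R * R -> R,
  [/\ 0 < eps, corner_equiv f a phi &
    forall t A, 0 < t <= eps -> measurable A -> A `<=` unit_square ->
    [/\ measurable_fun (A : set (plane R)) (f \o scale t),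
        forall p, A p -> 0 <= f (scale t p) &
        m (dilate t A) = ((t ^+ 2)%:E * \int[lebesgue2]_(p in A) (f (scale t p))%:E)%E]].
Proof.
case: hBL => [eps [f [/andP[eps0 eps1] [[mf f0 hf] [_ [_ [_ [_ [_ ce]]]]]]]]].
exists eps, f; split => // t A /andP[t0 te] mA A1.
have tD (p : plane R) : A p -> (`[0, eps] `*` `[0, eps]) (scale t p).
  move=> /A1 [/=]; rewrite !in_itv/= => /andP[p0 p1] /andP[q0 q1].
  by split; rewrite !(mulr_ge0 (ltW t0))//= (le_trans _ te)// ler_piMr// ltW.
have mD : measurable (`[0, eps] `*` `[0, eps] : set (plane R)) by exact: measurableX.
have dD : dilate t A `<=` `[0, eps] `*` `[0, eps].
  move=> p Ap; have := tD _ Ap; rewrite /scale/= !mulVKf ?gt_eqF//.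
have mdA : measurable (dilate t A) by exact: measurable_scaleI.
split.
- apply: (measurable_comp mD) mf _; last exact: measurable_funS (measurable_scale t).
  by move=> _ [p Ap <-]; exact: tD.
- by move=> p /tD; exact: f0.
rewrite (hf _ mdA dD) (ge0_integral_scale t0) ?scale_dilate//.
- exact: measurable_funS mf.
- by move=> p /dD; exact: f0.
Qed.

(** The Jacobian [t ^ 2] times the bound [C t ^ (a - 1)] on the compact unit square. The estimate is
    uniform in [A], so it also applies to thin rectangles varying with [t]. *)
Lemma BL_smooth_bound : exists t0 C : R, [/\ 0 < t0, 0 <= C &
  forall t (A : set (plane R)), 0 < t <= t0 -> measurable A -> A `<=` unit_square ->
    (m (dilate t A) <= (C * t `^ (a + 1))%:E * lebesgue2 A)%E].
Proof.
have [eps [f [eps0 ce hf]]] := BL_smooth_dilate.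
have [C hC] := ce.2 _ compact_unit_square unit_square_quadrant.
have [e e0 he] := near0_rightP hC.
exists (Num.min eps (e / 2)), (Num.max C 0); split.
- by rewrite lt_min eps0 divr_gt0.
- by rewrite le_max lexx orbT.
move=> t A /andP[t0]; rewrite le_min => /andP[teps te] mA A1.
have [mf f0 ->] := hf t A (introT andP (conj t0 teps)) mA A1.
have -> : t `^ (a + 1) = t ^+ 2 * t `^ (a - 1).
  rewrite -powR_mulrn ?ltW// -powRD; first by congr (_ `^ _); ring.
  by rewrite (gt_eqF t0) implybT.
have -> : ((Num.max C 0 * (t ^+ 2 * t `^ (a - 1)))%:E * lebesgue2 A =
    (t ^+ 2)%:E * ((Num.max C 0 * t `^ (a - 1))%:E * lebesgue2 A))%E.
  by rewrite muleA -EFinM mulrCA.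
have t20 : (0 <= (t ^+ 2)%:E)%E by rewrite lee_fin sqr_ge0.
apply: (lee_wpmul2l t20).
apply: (@le_trans _ _ (\int[lebesgue2]_(p in A) (cst (Num.max C 0 * t `^ (a - 1))%:E p))%E).
  apply: ae_ge0_le_integral => //.
  - exact/measurable_EFinP.
  - by move=> p _; rewrite lee_fin mulr_ge0 ?powR_ge0// le_max lexx orbT.
  apply: BL_smooth_ae => p hp Ap; rewrite lee_fin.
  have tt : 0 < t < e by rewrite t0 (le_lt_trans te)// ltr_pdivrMr// ltr_pMr// ltr1n.
  apply: le_trans (he _ tt _ (A1 _ Ap) (hp (unit_square_quadrant (A1 _ Ap)))) _.
  by rewrite ler_wpM2r ?powR_ge0// le_max lexx.
by rewrite integral_cst.
Qed.

(** Dominated convergence: the ray-wise clause of [corner_equiv] gives the pointwise limit, the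
    compact bound gives a constant dominating function. *)
Lemma BL_smooth_limit (s : R ^nat) (A : set (plane R)) :
  (forall n, 0 < s n) -> s @ \oo --> (0 : R) ->
  measurable A -> A `<=` unit_square ->
  ((s n `^ (- (a + 1)))%:E * m (dilate (s n) A))%E @[n --> \oo] -->
    (\int[lebesgue2]_(p in A) (phi p)%:E)%E.
Proof.
have [eps [f [eps0 ce hf]]] := BL_smooth_dilate.
have [C hC] := ce.2 _ compact_unit_square unit_square_quadrant.
have [e e0 he] := near0_rightP hC.
pose t0 := Num.min eps (e / 2).
have t00 : 0 < t0 by rewrite lt_min eps0 divr_gt0.
move=> s0 s_0 mA A1.
(* Truncation makes the domination hold for every [n]; eventually [u n = s n]. *)
pose u n := Num.min (s n) t0.
have u0 n : 0 < u n by rewrite lt_min s0.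
have ueps n : 0 < u n <= eps by rewrite u0 !ge_min lexx !orbT.
have ue n : 0 < u n < e.
  rewrite u0 !gt_min; apply/orP; right; apply/orP; right.
  by rewrite ltr_pdivrMr// ltr_pMr// ltr1n.
have us : \forall n \near \oo, u n = s n.
  have : \forall n \near \oo, s n < t0 by move/cvgr_lt : s_0; apply.
  by apply: filterS => n /ltW; rewrite /u => /min_idPl.
have u_0 : u @ \oo --> (0 : R).
  by apply: cvg_trans s_0; apply: near_eq_cvg; apply: filterS us.
pose F n (p : plane R) := (f (scale (u n) p) / u n `^ (a - 1))%:E.
have upow n : 0 < u n `^ (a - 1) by rewrite powR_gt0.
have : (\int[lebesgue2]_(p in A) F n p)%E @[n --> \oo] -->
    (\int[lebesgue2]_(p in A) (phi p)%:E)%E.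
  have [] // := @dominated_convergence _ _ _ lebesgue2 A mA F (EFin \o phi) (cst C%:E).
  - move=> n; have [mf _ _] := hf _ _ (ueps n) mA A1.
    by apply/measurable_EFinP; exact: measurable_funM.
  - by apply/measurable_EFinP; exact: BL_smooth_measurable.
  - apply: BL_smooth_ae => -[x y] hp Ap.
    have qp := unit_square_quadrant (A1 _ Ap); have php := hp qp.
    have := ce.1 x y qp.1 qp.2 php => /cvg_at_rightP/(_ u (conj u0 u_0)) h.
    apply/cvg_EFin; first exact: nearW.
    rewrite -[X in _ --> X]mul1r.
    rewrite (_ : _ \o _ = fun n => (f (u n * x, u n * y) / (u n `^ (a - 1) * phi (x, y))) * phi (x, y)).
      by apply: cvgM => //; exact: cvg_cst.
    apply/funext => n; rewrite /F/= invfM mulrA mulrVK ?unitfE ?gt_eqF//.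
  - apply/integrableP; split; first exact: measurable_cst.
    rewrite (_ : (fun x => _) = cst `|C%:E|%E)// integral_cst//.
    apply: lte_mul_pinfty => //.
    by apply: (le_lt_trans (lebesgue2_unit_le mA A1)); rewrite ltry.
  - apply: BL_smooth_ae => p hp n Ap.
    have qp := unit_square_quadrant (A1 _ Ap).
    have [_ f0 _] := hf _ _ (ueps n) mA A1.
    rewrite /F/= lee_fin ger0_norm; last by rewrite divr_ge0 ?f0// ltW.
    by rewrite ler_pdivrMr//; exact: (he _ (ue n) _ (A1 _ Ap) (hp qp)).
apply: cvg_trans; apply: near_eq_cvg; apply: filterS us => n <-.
have [mf f0 ->] := hf _ _ (ueps n) mA A1.
rewrite muleA -EFinM.
have -> : u n `^ (- (a + 1)) * u n ^+ 2 = (u n `^ (a - 1))^-1.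
  rewrite -powR_mulrn ?ltW// -powRN -powRD; first by congr (_ `^ _); ring.
  by rewrite (gt_eqF (u0 n)) implybT.
rewrite -ge0_integralZl_EFin//.
- by apply: eq_integral => p _; rewrite /F EFinM muleC.
- exact/measurable_EFinP.
- by rewrite invr_ge0 ltW.
Qed.

Lemma measurable_Delta : measurable (@Delta R : set (plane R)).
Proof.
have -> : @Delta R = unit_square `&` [set p : plane R | p.1 + p.2 <= 1].
  apply/seteqP; split => -[x y]; rewrite /Delta /unit_square/= !in_itv/=.
    by case=> -> ->.
  by case=> -[-> ->].
apply: measurableI; first exact: measurableX.
rewrite (_ : [set p : plane R | _] = setT `&` (fun p : plane R => p.1 + p.2) @^-1` `]-oo, 1]).
  by apply: measurable_funD => //; exact: measurable_itv.
by rewrite setTI; apply/seteqP; split => p; rewrite /= in_itv.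
Qed.

Lemma Delta_unit_square : @Delta R `<=` unit_square.
Proof. by move=> p [p1 p2 _]; split; rewrite /= in_itv. Qed.

(** A zero integral would make [phi] vanish almost everywhere on [Delta], which contains a square of
    area [1 / 4], against its positivity almost everywhere. *)
Lemma BL_smooth_Delta_gt0 : (0 < \int[lebesgue2]_(p in Delta) (phi p)%:E)%E.
Proof.
have mphi := BL_smooth_measurable measurable_Delta Delta_unit_square.
have q (p : R * R) : Delta p -> quadrant p.
  by move=> h; apply: unit_square_quadrant; exact: Delta_unit_square.
rewrite lt_neqAle integral_ge0 ?andbT; last first.
  by move=> p /q/BL_smooth_ge0; rewrite lee_fin.
apply/eqP => /esym i0.
have : (\int[lebesgue2]_(p in Delta) `|(EFin \o phi) p| = 0)%E.
  rewrite -[RHS]i0; apply: eq_integral => p; rewrite inE => /q/BL_smooth_ge0 ?.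
  by rewrite /= ger0_norm.
have mphi' : measurable_fun (Delta : set (plane R)) (EFin \o phi) by exact/measurable_EFinP.
move/(ae_eq_integral_abs lebesgue2 measurable_Delta mphi') => [N [mN N0 hN]].
have [M [mM M0 hM]] := BL_smooth_ae (fun p h => h).
have D_NM : Delta `<=` N `|` M.
  move=> p Dp; case: (pselect (M p)) => [|Mp]; first by right.
  left; apply: hN => /= /(_ Dp) [p0].
  have : quadrant p -> 0 < phi p by apply: contra_notP Mp => /hM.
  by move=> /(_ (q _ Dp)); rewrite p0 ltxx.
pose Q : set (plane R) := `[0, 1 / 2] `*` `[0, 1 / 2].
have mQ : measurable Q by exact: measurableX.
have QD : Q `<=` Delta.
  move=> [x y] [/=]; rewrite !in_itv/= => /andP[x0 x1] /andP[y0 y1].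
  by split; rewrite /= ?x0 ?y0/=; lra.
have : (lebesgue2 Q <= lebesgue2 (N `|` M))%E.
  by apply: le_measure; rewrite ?inE//; [exact: measurableU | move=> p /QD/D_NM].
have hQ : lebesgue2 Q = (1 / 2 * (1 / 2))%:E by rewrite /Q lebesgue2_box//; lra.
rewrite [leLHS]hQ.
by rewrite measureU0// N0 lee_fin; lra.
Qed.

End corner_density.

Lemma BL_smooth_gt0 (R : realType) (m : set (R * R) -> \bar R) a phi :
  BL_smooth m a phi -> 0 < a.
Proof. by case=> eps [f [_ [_ []]]]. Qed.

(* Since [C eta ^ (a + 1) (s / eta) = (C eta ^ a) s], thin strips of length [eta]
   along the sides carry an arbitrarily small fraction of their width. *)
Lemma BL_smooth_strip (R : realType) (m : set (R * R) -> \bar R) a phi :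
  BL_smooth m a phi -> forall kappa : R, 0 < kappa ->
  exists2 eta0 : R, 0 < eta0 & forall eta s, 0 < eta <= eta0 -> 0 <= s <= eta ->
    (m (`[0, s] `*` `[0, eta])%R <= (kappa * s)%:E)%E /\
    (m (`[0, eta] `*` `[0, s])%R <= (kappa * s)%:E)%E.
Proof.
move=> hBL kappa k0; have a0 := BL_smooth_gt0 hBL.
have [t0 [C [t00 C0 hC]]] := BL_smooth_bound hBL.
(* This gives [C * e1 ^ a <= kappa]; the [+ 1] covers [C = 0]. *)
pose e1 := (kappa / (C + 1)) `^ a^-1.
have kC : 0 < kappa / (C + 1) by rewrite divr_gt0// ltr_pwDr.
have e10 : 0 < e1 by rewrite powR_gt0.
exists (Num.min t0 e1); first by rewrite lt_min t00.
move=> eta s /andP[eta0]; rewrite le_min => /andP[eta_t0 eta_e1] /andP[s0 s_eta].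
have Ck : C * eta `^ a <= kappa.
  have h : eta `^ a <= kappa / (C + 1).
    have -> : kappa / (C + 1) = e1 `^ a.
      by rewrite /e1 -powRrM mulVf ?gt_eqF// powRr1// ltW.
    by rewrite ge0_ler_powR ?nnegrE// ltW.
  apply: (@le_trans _ _ (C * (kappa / (C + 1)))); first exact: ler_wpM2l.
  by rewrite mulrA ler_pdivrMr ?ltr_pwDr//; move: (C) (kappa) C0 k0 => C' k' C0 k0; nra.
have H (A : set (plane R)) : measurable A -> A `<=` unit_square ->
    lebesgue2 A = (s / eta)%:E -> (m (dilate eta A) <= (kappa * s)%:E)%E.
  move=> mA A1 lA; have et : 0 < eta <= t0 by rewrite eta0.
  apply: le_trans (hC _ _ et mA A1) _; rewrite [X in (_ * X)%E]lA -EFinM lee_fin.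
  have -> : eta `^ (a + 1) = eta `^ a * eta.
    by rewrite powRD ?powRr1 ?ltW// (gt_eqF eta0) implybT.
  have -> : C * (eta `^ a * eta) * (s / eta) = C * eta `^ a * s.
    by field; rewrite gt_eqF.
  exact: ler_wpM2r.
have s01 : 0 <= s / eta <= 1 by rewrite divr_ge0 ?(ltW eta0)//= ler_pdivrMr// mul1r.
have se0 : 0 <= s / eta by case/andP : s01.
have se1 : s / eta <= 1 by case/andP : s01.
have itv1 (x u : R) : (0 <= eta^-1 * x <= u / eta) = (0 <= x <= u).
  rewrite pmulr_rge0 ?invr_gt0// [eta^-1 * x]mulrC ler_pM2r ?invr_gt0//.
have itv2 (x : R) : (0 <= eta^-1 * x <= 1) = (0 <= x <= eta).
  by rewrite -(itv1 _ eta) divff ?gt_eqF.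
split.
- have -> : `[0, s] `*` `[0, eta] = dilate eta (`[0, s / eta] `*` `[0, 1]).
    by apply/seteqP; split => -[x y]; rewrite /dilate/= !in_itv/= itv1 itv2.
  apply: H; first exact: measurableX.
    move=> [x y] [/=]; rewrite !in_itv/= => /andP[x0 h] y1.
    by split; rewrite /= in_itv//= x0 (le_trans h se1).
  by rewrite lebesgue2_box// mulr1.
- have -> : `[0, eta] `*` `[0, s] = dilate eta (`[0, 1] `*` `[0, s / eta]).
    by apply/seteqP; split => -[x y]; rewrite /dilate/= !in_itv/= itv1 itv2.
  apply: H; first exact: measurableX.
    move=> [x y] [/=]; rewrite !in_itv/= => x1 /andP[y0 h].
    by split; rewrite /= in_itv//= y0 (le_trans h se1).
  by rewrite lebesgue2_box// mul1r.
Qed.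

(** * Coordinates and strips in a square *)

Section square_coordinates.
Context {R : realType}.
Implicit Types (S : square R) (b c : bool) (p q : R * R).

Definition axis_coord c p : R := if c then p.1 else p.2.
Definition sq c S : R := if c then sqx S else sqy S.

(* Distance, along the axis [c], to the bottom-left corner ([b = true]) or to
   the top-right corner ([b = false]) of [S]. *)
Definition dist b c S p : R :=
  if b then axis_coord c p - sq c S else sq c S + side S - axis_coord c p.

Definition inverted p q := (p.1 - q.1) * (p.2 - q.2) < 0.

(** Passing to the top-right corner negates both differences and preserves their product, so one
    argument serves both corners. *)
Lemma inverted_dist b S p q : inverted p q =
  ((dist b true S p - dist b true S q) * (dist b false S p - dist b false S q) < 0).
Proof. by rewrite /inverted; congr (_ < 0); case: b; rewrite /dist/axis_coord/=; ring. Qed.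

Lemma distC b c S p : dist (~~ b) c S p = side S - dist b c S p.
Proof. by case: b; rewrite /dist/=; ring. Qed.

Lemma square_setP S p :
  square_set S p <-> forall b c, 0 <= dist b c S p.
Proof.
rewrite /square_set /hside /vside /=; split.
  rewrite !in_itv/= => -[/andP[x0 x1] /andP[y0 y1]].
  by case; case; rewrite /dist/axis_coord/= subr_ge0.
move=> h; rewrite !in_itv/= -subr_ge0 -(subr_ge0 _ (sqx S + _)).
rewrite -(subr_ge0 (sqy S)) -(subr_ge0 _ (sqy S + _)).
by rewrite (h true true) (h false true) (h true false) (h false false).
Qed.

Lemma measurable_dist b c S : measurable_fun setT (dist b c S : plane R -> R).
Proof.
by case: b; case: c; rewrite /dist /axis_coord /=; apply: measurable_funB.
Qed.

Lemma measurable_dist_le b c S s : measurable [set p : plane R | dist b c S p <= s].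
Proof.
rewrite (_ : [set _ | _] = setT `&` (dist b c S) @^-1` `]-oo, s]).
  exact: measurable_dist.
by rewrite setTI; apply/seteqP; split => p; rewrite /= in_itv.
Qed.

Lemma measurable_dist_lt b c S s : measurable [set p : plane R | dist b c S p < s].
Proof.
rewrite (_ : [set _ | _] = setT `&` (dist b c S) @^-1` `]-oo, s[).
  exact: measurable_dist.
by rewrite setTI; apply/seteqP; split => p; rewrite /= in_itv.
Qed.

Lemma measurable_dist_gt b c S s : measurable [set p : plane R | s < dist b c S p].
Proof.
rewrite (_ : [set _ | _] = ~` [set p | dist b c S p <= s]).
  by apply: measurableC; exact: measurable_dist_le.
by apply/seteqP; split => p /=; [move=> h; apply/negP; rewrite -ltNge|
  move/negP; rewrite -ltNge].
Qed.

Lemma measurable_square S : measurable (square_set S : set (plane R)).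
Proof. by apply: measurableX; exact: measurable_itv. Qed.

Definition corner_image S b (Q : set (R * R)) : set (plane R) :=
  square_set S `&` [set p | Q (dist b true S p, dist b false S p)].

Definition triangle S b s : set (plane R) :=
  square_set S `&` [set p | dist b true S p + dist b false S p <= s].

Lemma measurable_triangle S b s : measurable (triangle S b s).
Proof.
apply: measurableI; first exact: measurable_square.
rewrite (_ : [set _ | _] = setT `&`
  (fun p => dist b true S p + dist b false S p) @^-1` `]-oo, s]).
  by apply: measurable_funD; [exact: measurable_dist|exact: measurable_dist|
    |exact: measurable_itv].
by rewrite setTI; apply/seteqP; split => p; rewrite /= in_itv.
Qed.

Variable mu : probability (plane R) R.

(** For [b = false] the flip brings the top-right corner to the origin, so that [TR_smooth] of the
    rescaled tile becomes [BL_smooth] of this measure. *)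
Definition corner_measure S b : set (R * R) -> \bar R :=
  if b then rescaled (restriction mu (square_set S)) S
  else pushforward (rescaled (restriction mu (square_set S)) S) flip.

Lemma corner_measureE S b (Q : set (R * R)) : 0 < side S ->
  mu (corner_image S b Q) =
  ((side S)%:E * corner_measure S b (scale (side S) @^-1` Q))%E.
Proof.
move=> d0.
have E (x y : R) : x + y - x = y by ring.
have h (A : set (R * R)) : ((fun p : R * R => (sqx S + side S * p.1, sqy S + side S * p.2)) @` A)
    = [set p | A (scale (side S)^-1 (dist true true S p, dist true false S p))].
  apply/seteqP; split => [_ [p Ap <-]|p /= Ap].
    rewrite /= /dist /axis_coord /scale/= !E !mulKf ?gt_eqF//.
    by case: p Ap.
  eexists; first exact: Ap.
  by rewrite /scale/= !mulVKf ?gt_eqF// /dist/axis_coord/= !subrKC; case: p Ap.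
have -> : corner_measure S b (scale (side S) @^-1` Q) =
    ((side S)^-1%:E * mu (corner_image S b Q))%E.
  case: b; rewrite /corner_measure /pushforward /rescaled /restriction;
    congr (_ * mu _)%E; rewrite h setIC /corner_image; congr (_ `&` _);
    apply/seteqP; split => p /=; rewrite /scale/flip/= ?mulVKf ?gt_eqF//.
  - by rewrite !mulrBr !mulr1 !mulVKf ?gt_eqF// /dist/axis_coord/= !opprB !addrA ![side S + _]addrC.
  - by rewrite !mulrBr !mulr1 !mulVKf ?gt_eqF// /dist/axis_coord/= !opprB !addrA ![side S + _]addrC.
by rewrite muleA -EFinM divff ?gt_eqF// mul1e.
Qed.

(** The part of a side strip that lies in the corner box of size [eta]; it is discarded in lower
    bounds. *)
Definition strip S b c s eta : set (plane R) :=
  square_set S `&` [set p | dist b c S p <= s /\ dist b (~~ c) S p <= eta].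

Lemma measurable_strip S b c s eta : measurable (strip S b c s eta).
Proof.
rewrite /strip (_ : [set p | _ /\ _] =
  [set p | dist b c S p <= s] `&` [set p | dist b (~~ c) S p <= eta])//.
by apply: measurableI; [exact: measurable_square|apply: measurableI];
  exact: measurable_dist_le.
Qed.

Lemma strip_small S b a phi : 0 < side S -> BL_smooth (corner_measure S b) a phi ->
  forall kappa : R, 0 < kappa ->
  exists2 eta0 : R, 0 < eta0 & forall eta s c, 0 < eta <= eta0 -> 0 <= s <= eta ->
    (mu (strip S b c s eta) <= (kappa * s)%:E)%E.
Proof.
move=> d0 hBL kappa k0; have [e0 e00 he] := BL_smooth_strip hBL k0.
exists (side S * e0); first by rewrite mulr_gt0.
move=> eta s c /andP[eta0 ete] /andP[s0 se].
have h1 : 0 < eta / side S <= e0 by rewrite divr_gt0//= ler_pdivrMr// mulrC.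
have h2 : 0 <= s / side S <= eta / side S by rewrite divr_ge0 ?(ltW d0)//= ler_pM2r ?invr_gt0.
have [hl hr] := he _ _ h1 h2.
have itvE (u x : R) : 0 <= x -> (x \in `[0, u]) = (x <= u).
  by move=> x0; rewrite in_itv/= x0.
pose Q : set (R * R) := if c then `[0, s] `*` `[0, eta] else `[0, eta] `*` `[0, s].
have -> : strip S b c s eta = corner_image S b Q.
  rewrite /strip/corner_image /Q; apply/seteqP; split => p [Sp];
    have := (square_setP _ _).1 Sp; move=> h; rewrite /=;
    case: c Q => Q /=; rewrite !itvE ?h// => -[? ?]; split=> //.
have -> : (mu (corner_image S b Q) = (side S)%:E * corner_measure S b (scale (side S) @^-1` Q))%E.
  exact: corner_measureE.
have E (u x : R) : (0 <= side S * x <= u) = (0 <= x <= u / side S).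
  by rewrite pmulr_rge0// ler_pdivlMr// mulrC.
have -> : (kappa * s)%:E = ((side S)%:E * (kappa * (s / side S))%:E)%E.
  by rewrite -EFinM; congr EFin; field; rewrite gt_eqF.
have d0' : (0 <= (side S)%:E)%E by rewrite lee_fin ltW.
apply: (lee_wpmul2l d0').
rewrite /Q; case: c {Q}.
  apply: le_trans hl; rewrite le_eqVlt; apply/orP; left; apply/eqP; congr (corner_measure S b _).
  by apply/seteqP; split => -[x y]; rewrite /= !in_itv/= !E.
apply: le_trans hr; rewrite le_eqVlt; apply/orP; left; apply/eqP; congr (corner_measure S b _).
by apply/seteqP; split => -[x y]; rewrite /= !in_itv/= !E.
Qed.

Lemma dilate_Delta (s : R) : 0 < s ->
  dilate s Delta = [set p : R * R | [&& 0 <= p.1, 0 <= p.2 & p.1 + p.2 <= s]].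
Proof.
move=> s0; apply/seteqP; split => -[x y]; rewrite /dilate /Delta /scale/=.
  rewrite -mulrDr !pmulr_rge0 ?invr_gt0// ![s^-1 * _]mulrC !ler_pdivrMr// !mul1r.
  by case=> /andP[-> _] /andP[-> _] ->.
case/and3P => x0 y0 xy; rewrite -mulrDr !pmulr_rge0 ?invr_gt0// x0 y0/=.
by rewrite ![s^-1 * _]mulrC !ler_pdivrMr// !mul1r; split => //; lra.
Qed.

(** With [d = side S], the mass is [d] times the rescaled mass at size [s / d], of order [d (s / d)
    ^ (a + 1) = d ^ (- a) s ^ (a + 1)]. *)
Lemma triangle_limit S b a phi (s : R ^nat) :
  0 < side S -> BL_smooth (corner_measure S b) a phi ->
  (forall n, 0 < s n) -> s @ \oo --> (0 : R) ->
  ((s n `^ (- (a + 1)))%:E * mu (triangle S b (s n)))%E @[n --> \oo] -->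
    ((side S `^ (- a))%:E * \int[lebesgue2]_(p in Delta) (phi p)%:E)%E.
Proof.
move=> d0 hBL s0 s_0; set I := (\int[lebesgue2]_(p in _) _)%E.
pose u n := s n / side S.
have u0 n : 0 < u n by rewrite divr_gt0.
have u_0 : u @ \oo --> (0 : R).
  by rewrite -[X in _ --> X](mul0r (side S)^-1); apply: cvgM => //; exact: cvg_cst.
have := BL_smooth_limit hBL u0 u_0 measurable_Delta Delta_unit_square.
rewrite -/I => h.
have h2 : ((side S `^ (- a))%:E * ((u n `^ (- (a + 1)))%:E * corner_measure S b (dilate (u n) Delta)))%E
    @[n --> \oo] --> ((side S `^ (- a))%:E * I)%E by exact: cvgeZl.
apply: cvg_trans h2; apply: near_eq_cvg; apply: nearW => n.
have -> : triangle S b (s n) = corner_image S b (dilate (s n) Delta).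
  rewrite dilate_Delta// /corner_image/=; apply/seteqP; split => p [Sp] /=.
    by have h0 := (square_setP _ _).1 Sp; rewrite !h0.
  by case/and3P.
rewrite corner_measureE//.
have -> : scale (side S) @^-1` dilate (s n) Delta = dilate (u n) Delta.
  by apply/seteqP; split => -[x y]; rewrite /dilate /scale/= /u invf_div !mulrA ![_^-1 * side S]mulrC.
rewrite !muleA -!EFinM; congr (_%:E * _)%E.
rewrite /u -(powR_inv1 (ltW d0)).
rewrite powRM ?powR_ge0 ?(ltW (s0 n))// -powRrM mulrCA -powRD; last first.
  by rewrite (gt_eqF d0) implybT.
have -> : - a + -1 * - (a + 1) = 1 by ring.
by rewrite powRr1 ?ltW.
Qed.

End square_coordinates.

Arguments dist : simpl never.

(** * Strips in a tile with Lebesgue marginals *)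

Section marginals.
Context {R : realType}.
Variable mu : probability (plane R) R.
Implicit Types (S : square R) (b c : bool) (p q : R * R).

Definition axis_side c S : set R := `[sq c S, sq c S + side S].

Definition on_axis c (A : set R) : set (plane R) := [set p | A (axis_coord c p)].

Lemma measurable_on_axis c A : measurable A -> measurable (on_axis c A).
Proof.
move=> mA; rewrite -[X in measurable X]setTI /on_axis.
by case: c; [exact: measurable_fst | exact: measurable_snd].
Qed.

Definition has_marginals S : Prop := 0 < side S /\
  forall c (A : set R), measurable A -> A `<=` axis_side c S ->
    mu (square_set S `&` on_axis c A) = lebesgue_measure A.

Definition slab S b c s : set (plane R) :=
  square_set S `&` [set p | dist b c S p < s].

(** A slab without the corner box. A point of the box at distance at least [s] along [c] is inverted
    with the whole band: it is farther from the corner along [c] and closer along the other axis. *)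
Definition band S b c s eta : set (plane R) :=
  square_set S `&` [set p | dist b c S p < s /\ eta < dist b (~~ c) S p].

Definition inner S : set (plane R) := [set p | forall b c, 0 < dist b c S p].

Lemma measurable_slab S b c s : measurable (slab S b c s).
Proof.
by apply: measurableI; [exact: measurable_square|exact: measurable_dist_lt].
Qed.

Lemma measurable_band S b c s eta : measurable (band S b c s eta).
Proof.
apply: measurableI; first exact: measurable_square.
rewrite (_ : [set _ | _] = [set p | dist b c S p < s] `&` [set p | eta < dist b (~~ c) S p])//.
by apply: measurableI; [exact: measurable_dist_lt|exact: measurable_dist_gt].
Qed.

Lemma measurable_inner S : measurable (inner S).
Proof.
rewrite (_ : inner S = ([set p | 0 < dist true true S p] `&` [set p | 0 < dist true false S p])
   `&` ([set p | 0 < dist false true S p] `&` [set p | 0 < dist false false S p])).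
  by do 2!apply: measurableI; exact: measurable_dist_gt.
apply/seteqP; split => [p h|p [[? ?] [? ?]]]; first by split; split; exact: h.
by case; case.
Qed.

Lemma inner_sub S : inner S `<=` square_set S.
Proof. by move=> p h; apply/square_setP => b c; exact/ltW/h. Qed.

Lemma measurable_corner_image S b (Q : set (plane R)) : measurable Q ->
  measurable (corner_image S b Q).
Proof.
move=> mQ; apply: measurableI; first exact: measurable_square.
pose f p : plane R := (dist b true S p, dist b false S p).
have mf : measurable_fun setT (f : plane R -> plane R).
  by apply: measurable_fun_pair; exact: measurable_dist.
by rewrite -[X in measurable X]setTI; exact: mf.
Qed.

Section one_square.
Variable S : square R.
Hypothesis hS : has_marginals S.

Let d0 : 0 < side S := hS.1.

Lemma mu_square : mu (square_set S) = (side S)%:E.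
Proof.
have := hS.2 true (axis_side true S) (measurable_itv _) (fun _ h => h).
rewrite lebesgue_measure_itv/= lte_fin ltrDl d0 -EFinD addrAC subrr add0r => <-.
by congr (mu _); rewrite setIidl//; move=> p [].
Qed.

Lemma mu_slab b c s : 0 <= s <= side S -> mu (slab S b c s) = s%:E.
Proof.
move=> /andP[s0 sd].
pose A : set R := if b then `[sq c S, sq c S + s[%classic
  else `]sq c S + side S - s, sq c S + side S]%classic.
have mA : measurable A by rewrite /A; case: (b).
have As : A `<=` axis_side c S.
  move=> x; rewrite /A /axis_side; case: (b); rewrite /= !in_itv/= => /andP[? ?]; apply/andP; split; lra.
have -> : slab S b c s = square_set S `&` on_axis c A.
  apply/seteqP; split => p [Sp] /=; have h := (square_setP _ _).1 Sp;
    have := h true c; have := h false c; rewrite /on_axis /A; case: (b);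
    rewrite /dist/= in_itv/= => h1 h2.
  - by move=> h3; split=> //; apply/andP; split; lra.
  - by move=> h3; split=> //; apply/andP; split; lra.
  - by move=> /andP[h3 h4]; split=> //; rewrite /dist/=; lra.
  - by move=> /andP[h3 h4]; split=> //; rewrite /dist/=; lra.
rewrite hS.2// /A; case: (b); rewrite lebesgue_measure_itv/= lte_fin.
  rewrite ltrDl; case: ltgtP s0 => // [s0 _|<- _//].
  by rewrite -EFinD addrAC subrr add0r.
rewrite ltrBlDr ltrDl; case: ltgtP s0 => // [s0 _|<- _//].
by rewrite -EFinD opprB addrC subrK.
Qed.

Lemma mu_line c (x : R) : mu (square_set S `&` on_axis c [set x]) = 0%E.
Proof.
have [xS|xS] := pselect (axis_side c S x).
  by rewrite hS.2//; [exact: lebesgue_measure_set1|move=> _ ->].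
rewrite (_ : _ `&` _ = set0) ?measure0// -subset0 => p [[px py] /= pc]; apply: xS.
by rewrite -pc; case: (c).
Qed.

Lemma mu_dist_line b c s : mu (square_set S `&` [set p | dist b c S p = s]) = 0%E.
Proof.
rewrite (_ : [set p | _] = on_axis c [set if b then sq c S + s else sq c S + side S - s]).
  exact: mu_line.
by apply/seteqP; split => p; rewrite /on_axis /= /dist; case: (b) => h; lra.
Qed.

Lemma mu_inner : mu (inner S) = (side S)%:E.
Proof.
apply/eqP; rewrite eq_le -{1}mu_square le_measure ?inE//=; last 3 first.
- exact: measurable_inner.
- exact: measurable_square.
- exact: inner_sub.
pose L b c : set (plane R) := square_set S `&` [set p | dist b c S p = 0].
have mL b c : measurable (L b c).
  apply: measurableI; first exact: measurable_square.
  rewrite (_ : [set p | _] = [set p | dist b c S p <= 0] `\` [set p | dist b c S p < 0]).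
    by apply: measurableD; [exact: measurable_dist_le|exact: measurable_dist_lt].
  apply/seteqP; split => p /=; first by move=> ->; rewrite lexx ltxx.
  by case=> ? /negP; rewrite -leNgt => ?; apply/eqP; rewrite eq_le; apply/andP.
rewrite -mu_square.
have sub : square_set S `<=`
    inner S `|` (L true true `|` (L true false `|` (L false true `|` L false false))).
  move=> p Sp; have h := (square_setP _ _).1 Sp.
  have [|] := pselect (inner S p); first by left.
  move=> /existsNP[b /existsNP[c /negP]]; rewrite -leNgt => hbc; right.
  have e : dist b c S p = 0 by apply/eqP; rewrite eq_le hbc h.
  have Lbc : L b c p by [].
  by move: Lbc {hbc e}; case: b; case: c; [left|right;left|right;right;left|right;right;right].
have mI := measurable_inner S.
set N := L true true `|` (L true false `|` (L false true `|` L false false)) in sub.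
have mN : measurable N by do !apply: measurableU.
have L0 b c : mu (L b c) = 0%E by exact: mu_dist_line.
have N0 : mu N = 0%E.
  by do ?apply: null_set_setU => //; do ?apply: measurableU => //; exact: L0.
apply: (@le_trans _ _ (mu (inner S `|` N))).
  apply: le_measure; rewrite ?inE//; first exact: measurable_square.
  exact: measurableU.
by rewrite measureU0.
Qed.

Lemma mu_band_le b c s eta : 0 <= s <= side S -> (mu (band S b c s eta) <= s%:E)%E.
Proof.
move=> h; rewrite -(mu_slab b c h); apply: le_measure; rewrite ?inE.
- exact: measurable_band.
- exact: measurable_slab.
by move=> p [? []].
Qed.

Lemma mu_band_ge b c s eta kappa : 0 <= s <= side S ->
  (mu (strip S b c s eta) <= (kappa * s)%:E)%E ->
  ((s - kappa * s)%:E <= mu (band S b c s eta))%E.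
Proof.
move=> h hk; rewrite EFinB leeBlDr//.
apply: le_trans (leeD2l _ hk).
rewrite -(mu_slab b c h).
apply: (@le_trans _ _ (mu (band S b c s eta `|` strip S b c s eta))).
  apply: le_measure; rewrite ?inE.
  - exact: measurable_slab.
  - by apply: measurableU; [exact: measurable_band|exact: measurable_strip].
  move=> p [Sp /= ps]; case: (ltP eta (dist b (~~ c) S p)) => hp; first by left.
  by right; split=> //; split=> //; exact: ltW.
by apply: measureU2; [exact: measurable_band|exact: measurable_strip].
Qed.

(* Away from the two corner boxes, a point of [S] is inverted with all the points
   of one of these four sets: the two sets provided by [corner_balanced], and for
   each corner the part of a side strip outside of the corner box. *)
Definition off_corner eta (y : R) (i : bool * bool) : set (plane R) :=
  square_set S `&` [set p |
    if i.1 then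
      if i.2 then dist true true S p <= eta /\ y < dist true false S p
      else dist false true S p <= eta /\ dist true false S p < y
    else eta < dist i.2 true S p /\ dist i.2 false S p <= eta].

Lemma measurable_off_corner eta y i : measurable (off_corner eta y i).
Proof.
apply: measurableI; first exact: measurable_square.
case: i => [[] []].
- exact: (measurableI _ _ (measurable_dist_le true true S eta)
    (measurable_dist_gt true false S y)).
- exact: (measurableI _ _ (measurable_dist_le false true S eta)
    (measurable_dist_lt true false S y)).
- exact: (measurableI _ _ (measurable_dist_gt true true S eta)
    (measurable_dist_le true false S eta)).
- exact: (measurableI _ _ (measurable_dist_gt false true S eta)
    (measurable_dist_le false false S eta)).
Qed.

(** A point at height at most [y] and off the left strip is inverted with the upper left set; one at
    height at least [y] and off the right strip, with the lower right set. What remains lies low in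
    the left strip or high in the right strip: either in a corner box, or inverted with the rest of
    the bottom or top strip. *)
Lemma off_corner_inv eta y p : 0 < eta < side S / 2 -> square_set S p ->
  (exists b, forall c, dist b c S p <= eta) \/
  (exists i, forall q, off_corner eta y i q -> inverted p q).
Proof.
move=> /andP[e0 e2] Sp; have h := (square_setP _ _).1 Sp.
pose x := dist true true S p; pose z := dist true false S p.
have fx : dist false true S p = side S - x by rewrite -(distC true).
have fz : dist false false S p = side S - z by rewrite -(distC true).
have fq q c : dist false c S q = side S - dist true c S q by rewrite -(distC true).
have inv1 (a b u v : R) : a < u -> v < b -> (a - u) * (b - v) < 0.
  by move=> ? ?; rewrite nmulr_rlt0 ?subr_gt0// subr_lt0.
have inv2 (a b u v : R) : u < a -> b < v -> (a - u) * (b - v) < 0.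
  by move=> ? ?; rewrite mulrC inv1.
have A1 : eta < x -> z <= y ->
    exists i, forall q, off_corner eta y i q -> inverted p q.
  move=> ex zy; exists (true, true) => q [Sq /= [q1 q2]].
  by rewrite (inverted_dist true S); apply: inv2; [exact: le_lt_trans ex|exact: le_lt_trans q2].
have A2 : x < side S - eta -> y <= z ->
    exists i, forall q, off_corner eta y i q -> inverted p q.
  move=> ex zy; exists (true, false) => q [Sq /= [q1 q2]].
  rewrite fq in q1.
  rewrite (inverted_dist true S); apply: inv1; last exact: lt_le_trans zy.
  by apply: (lt_le_trans ex); lra.
have A3 b : dist b true S p <= eta -> eta < dist b false S p ->
    exists i, forall q, off_corner eta y i q -> inverted p q.
  move=> h1 h2; exists (false, b) => q [Sq /= [q1 q2]].
  by rewrite (inverted_dist b S); apply: inv1; [exact: le_lt_trans q1|exact: le_lt_trans h2].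
have [xe|ex] := leP x eta.
  have [zy|yz] := ltP z y; last by right; apply: A2 => //; lra.
  have [ze|ez] := leP z eta; first by left; exists true; case.
  by right; apply: (A3 true).
have [zy|yz] := leP z y; first by right; exact: A1.
have [xe|ex'] := ltP x (side S - eta); first by right; apply: A2 => //; exact: ltW.
have h1 : dist false true S p <= eta by rewrite fx; lra.
have [ze|ez] := leP (dist false false S p) eta.
  by left; exists false; case.
by right; apply: (A3 false).
Qed.

(** Corner balance at [eta / side S] provides two of the sets and the height [y = rho * side S]. For
    the other two, a slab of width [eta] has mass [eta], more than its corner box. *)
Lemma off_corner_gt0 : corner_balanced (corner_measure mu S true) ->
  forall eta, 0 < eta <= side S / 2 ->
  (forall b, (mu (strip S b true eta eta) < eta%:E)%E) ->
  exists y : R, forall i, (0 < mu (off_corner eta y i))%E.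
Proof.
move=> cb eta /andP[e0 e2] hs.
have e1 : 0 < eta / side S <= 1 / 2.
  by rewrite divr_gt0//= ler_pdivrMr// mulrC mul1r; move: e2; rewrite mulrC; lra.
have [rho rho01 [h1 h2]] := cb _ e1.
exists (rho * side S).
have mO := measurable_off_corner eta (rho * side S).
have strip_gt0 b : (0 < mu (off_corner eta (rho * side S) (false, b)))%E.
  have slabE : mu (slab S b false eta) = eta%:E by apply: mu_slab; apply/andP; split; lra.
  have mslab := measurable_slab S b false eta.
  have mstrip := measurable_strip S b true eta eta.
  have mo := mO (false, b).
  have : (mu (slab S b false eta) <=
      mu (off_corner eta (rho * side S) (false, b) `|` strip S b true eta eta))%E.
    apply: le_measure; rewrite ?inE//; first exact: measurableU.
    move=> p [Sp /= pe]; have [h|h] := leP (dist b true S p) eta; [right|left];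
      by split => //; split => //; exact: ltW.
  move=> /le_trans/(_ (measureU2 mu mo mstrip)); rewrite slabE => h.
  rewrite ltNge; apply/negP => o0.
  by have := le_trans h (leeD o0 (lexx _)); rewrite add0e leNgt hs.
(* The rectangles of [corner_balanced] are closed whereas [off_corner] is strict at height [y]; the
   difference lies on a horizontal line, which is null. *)
have gt0 (Q : set (R * R)) i : measurable (corner_image S true Q) ->
    (0 < corner_measure mu S true (scale (side S) @^-1` Q))%E ->
    corner_image S true Q `<=` off_corner eta (rho * side S) i `|`
      (square_set S `&` [set p | dist true false S p = rho * side S]) ->
    (0 < mu (off_corner eta (rho * side S) i))%E.
  move=> mQ Q0 sub; set L := square_set S `&` _ in sub.
  have mL : measurable L.
    apply: measurableI; first exact: measurable_square.
    rewrite (_ : [set p | _] = [set p | dist true false S p <= rho * side S] `\`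
        [set p | dist true false S p < rho * side S]).
      by apply: measurableD; [exact: measurable_dist_le|exact: measurable_dist_lt].
    apply/seteqP; split => p /=; first by move=> ->; rewrite lexx ltxx.
    by case=> ? /negP; rewrite -leNgt => ?; apply/eqP; rewrite eq_le; apply/andP.
  have L0 : mu L = 0%E by exact: mu_dist_line.
  rewrite -(measureU0 (mO i) mL L0).
  apply: (@lt_le_trans _ _ (mu (corner_image S true Q))).
    by rewrite corner_measureE// mule_gt0// lte_fin.
  by apply: le_measure; rewrite ?inE//; exact: measurableU.
have mi (u v u' v' : R) : measurable (`[u, v] `*` `[u', v'] : set (plane R)).
  exact: measurableX.
have E1 (x : R) : (0 <= side S * x <= eta) = (0 <= x <= eta / side S).
  by rewrite pmulr_rge0// ler_pdivlMr// mulrC.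
have E2 (x u : R) : (u * side S <= side S * x) = (u <= x).
  by rewrite mulrC ler_pM2l.
have E3 (x u : R) : (side S * x <= u * side S) = (x <= u).
  by rewrite [_ * x]mulrC ler_pM2r.
have E4 (x : R) : (side S - eta <= side S * x) = (1 - eta / side S <= x).
  by rewrite -(ler_pM2l d0 (1 - _)) mulrBr mulr1 mulrCA divff ?mulr1 ?gt_eqF.
have E5 (x : R) : (side S * x <= side S) = (x <= 1).
  by rewrite -[X in _ <= X]mul1r E3.
have E6 (x : R) : (0 <= side S * x) = (0 <= x) by rewrite pmulr_rge0.
have hd p b c : square_set S p -> 0 <= dist b c S p.
  by move=> Sp; exact: (square_setP _ _).1.
case=> [[] []].
- apply: (gt0 (`[0, eta] `*` `[rho * side S, side S])).
  + by apply: measurable_corner_image; exact: mi.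
  + apply: lt_le_trans h1 _; rewrite le_eqVlt; apply/orP; left; apply/eqP.
    congr (corner_measure mu S true _).
    by apply/seteqP; split => -[x y]; rewrite /= !in_itv/= E1 E2 E5.
  + move=> p [Sp [/=]]; rewrite !in_itv/= => /andP[_ p1] /andP[].
    rewrite le_eqVlt => /orP[/eqP p2 _|p2 _]; [right|left]; split => //.
- apply: (gt0 (`[side S - eta, side S] `*` `[0, rho * side S])).
  + by apply: measurable_corner_image; exact: mi.
  + apply: lt_le_trans h2 _; rewrite le_eqVlt; apply/orP; left; apply/eqP.
    congr (corner_measure mu S true _).
    by apply/seteqP; split => -[x y]; rewrite /= !in_itv/= E3 E4 E5 E6.
  + move=> p [Sp [/=]]; rewrite !in_itv/= => /andP[p1 _] /andP[_].
    rewrite le_eqVlt => /orP[/eqP p2|p2]; [right|left]; split => //=.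
    by split => //; rewrite (distC true); lra.
- exact: strip_gt0.
- exact: strip_gt0.
Qed.

End one_square.
End marginals.

(** * Geometry of tilings *)

Lemma mulr_lt0_cases (D : realDomainType) (a b : D) :
  (a * b < 0) = ((a < 0) && (0 < b)) || ((0 < a) && (b < 0)).
Proof.
case: (ltgtP a 0) => [a0|a0|->]; last by rewrite mul0r ltxx.
  by rewrite nmulr_rlt0// orbF.
by rewrite pmulr_rlt0.
Qed.

Section tiling_geometry.
Context {R : realType} {k : nat}.
Variables (T : 'I_k -> square R) (mu : probability (plane R) R).
Hypothesis hT : tiling T.
Implicit Types (l m : 'I_k) (c : bool).

Lemma tiling_side_gt0 l : 0 < side (T l).
Proof. by case: hT => h _ _ _; case: (h l). Qed.

Lemma tiling_cover c : `[0, 1] `<=` \bigcup_l axis_side c (T l).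
Proof. by case: hT => _ _ [h1 _] [h2 _]; case: c. Qed.

Lemma tiling_axis_side01 c l : axis_side c (T l) `<=` `[0, 1].
Proof.
case: hT => h _ _ _ x; rewrite /axis_side /= in_itv/= => /andP[x1 x2].
have [d0 sub] := h l.
case: c x1 x2 => x1 x2.
- suff /sub[] : square_set (T l) (x, sqy (T l)) by [].
  by split; rewrite /hside /vside /= in_itv/=; [rewrite x1|rewrite lexx lerDl ltW].
- suff /sub[] : square_set (T l) (sqx (T l), x) by [].
  by split; rewrite /hside /vside /= in_itv/=; [rewrite lexx lerDl ltW|rewrite x1].
Qed.

(** Otherwise the midpoint of the overlap would belong to both interiors. *)
Lemma tiling_sep c l m : l != m ->
  sq c (T l) + side (T l) <= sq c (T m) \/ sq c (T m) + side (T m) <= sq c (T l).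
Proof.
move=> lm; have [//|h1] := leP (sq c (T l) + side (T l)) (sq c (T m)); first by left.
have [//|h2] := leP (sq c (T m) + side (T m)) (sq c (T l)); first by right.
exfalso; move/eqP: lm; apply.
have tv : trivIset setT (fun l => interior (axis_side c (T l))).
  by case: hT => _ _ [_ t1] [_ t2]; case: (c).
apply: tv => //; rewrite /axis_side !interior_itv_bnd.
have dl := tiling_side_gt0 l; have dm := tiling_side_gt0 m.
pose u := Num.max (sq c (T l)) (sq c (T m)).
pose v := Num.min (sq c (T l) + side (T l)) (sq c (T m) + side (T m)).
have uv : u < v by rewrite /u /v gt_max !lt_min !ltrDl dl dm h1 h2.
have [ul um] : sq c (T l) <= u /\ sq c (T m) <= u by rewrite /u !le_max !lexx orbT.
have [vl vm] : v <= sq c (T l) + side (T l) /\ v <= sq c (T m) + side (T m).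
  by rewrite /v !ge_min !lexx orbT.
by exists ((u + v) / 2); split; rewrite /= in_itv/=; apply/andP; split; lra.
Qed.

Definition inverted_squares l m : bool :=
  (sq true (T l) - sq true (T m)) * (sq false (T l) - sq false (T m)) < 0.

(** Labels increase with [sqx] and [tiling_perm] with [sqy], so the permutation can be replaced by
    the positions of the squares. *)
Lemma perm_inversionsE l m :
  (m \in perm_inversions (tiling_perm T) l) = inverted_squares l m.
Proof.
rewrite inE /inverted_squares.
have hx (i j : 'I_k) : (i < j)%N = (sq true (T i) < sq true (T j)).
  case: hT => _ h _ _; rewrite /sq; case: (ltngtP i j) => [/h ->//|/h/ltW|/val_inj ->].
    by rewrite leNgt => /negbTE.
  by rewrite ltxx.
have hy i j := tiling_permP hT i j.
by rewrite !mulr_lt0_cases !subr_lt0 !subr_gt0 !ltz_nat !hy !hx.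
Qed.

(** Tiles may share boundary lines; taking one of the two points in an open tile makes both
    coordinate comparisons strict. *)
Lemma inverted_squares_inner l m p q : inverted_squares l m ->
  square_set (T l) p -> inner (T m) q -> inverted p q.
Proof.
move=> lm /square_setP hp hq.
have d0 := tiling_side_gt0.
have nlm : l != m.
  by apply/eqP => e; move: lm; rewrite e /inverted_squares !subrr mul0r ltxx.
have h c : (sq c (T l) < sq c (T m) -> axis_coord c p < axis_coord c q) /\
           (sq c (T m) < sq c (T l) -> axis_coord c q < axis_coord c p).
  have p1 := hp true c; have p2 := hp false c.
  have q1 := hq true c; have q2 := hq false c; rewrite /dist in p1 p2 q1 q2.
  have := d0 l; have := d0 m.
  by case: (tiling_sep c nlm) => s dl dm; split=> ?; lra.
move: lm; rewrite /inverted_squares /inverted.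
have [x1 x2] := h true; have [y1 y2] := h false; rewrite /axis_coord /sq in x1 x2 y1 y2 *.
rewrite !mulr_lt0_cases !subr_lt0 !subr_gt0 => /orP[/andP[h1 h2]|/andP[h1 h2]]; apply/orP.
  by left; rewrite x1// y2.
by right; rewrite x2// y1.
Qed.

(** Closed tiles suffice in this direction, since an inversion of points is already strict in both
    coordinates. *)
Lemma inverted_squares_of_points l m p q : l != m ->
  square_set (T l) p -> square_set (T m) q -> inverted p q -> inverted_squares l m.
Proof.
move=> nlm /square_setP hp /square_setP hq.
have d0 := tiling_side_gt0.
have h c : (axis_coord c p < axis_coord c q -> sq c (T l) < sq c (T m)) /\
           (axis_coord c q < axis_coord c p -> sq c (T m) < sq c (T l)).
  have p1 := hp true c; have p2 := hp false c.
  have q1 := hq true c; have q2 := hq false c; rewrite /dist in p1 p2 q1 q2.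
  have := d0 l; have := d0 m.
  by case: (tiling_sep c nlm) => s dl dm; split=> ?; lra.
rewrite /inverted_squares /inverted.
have [x1 x2] := h true; have [y1 y2] := h false; rewrite /axis_coord in x1 x2 y1 y2 *.
rewrite !mulr_lt0_cases !subr_lt0 !subr_gt0 => /orP[/andP[h1 h2]|/andP[h1 h2]]; apply/orP.
  by left; rewrite x1// y2.
by right; rewrite x2// y1.
Qed.

Lemma inner_disjoint l m p : inner (T l) p -> inner (T m) p -> l = m.
Proof.
move=> hl hm; apply/eqP/negPn/negP => /(tiling_sep true).
have p1 := hl true true; have p2 := hl false true.
have q1 := hm true true; have q2 := hm false true; rewrite /dist in p1 p2 q1 q2.
by case; lra.
Qed.

Hypotheses (hmu : permuton mu) (mu1 : mu (\bigcup_l square_set (T l)) = 1%E).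

Definition tiles : set (plane R) := \bigcup_l square_set (T l).

Lemma measurable_tiles : measurable tiles.
Proof. by apply: fin_bigcup_measurable => // l _; exact: measurable_square. Qed.

Lemma permuton_axis c (A : set R) : measurable A -> A `<=` `[0, 1] ->
  mu (unit_square `&` on_axis c A) = lebesgue_measure A.
Proof.
move=> mA A1; have [h1 h2] := hmu mA A1; case: c.
  rewrite -h2; congr (mu _); apply/seteqP; split => -[x y]; rewrite /on_axis/=.
    by case=> -[? ?].
  by case=> Ax ?; split => //; split => //; exact: A1.
rewrite -h1; congr (mu _); apply/seteqP; split => -[x y]; rewrite /on_axis/=.
  by case=> -[? ?].
by case=> ? Ay; split => //; split => //; exact: A1.
Qed.

(** Over a subset of a side of [T l], other tiles can only contribute at the two endpoints of that
    side, and the complement of the tiles is null; so all the mass given by the permuton marginal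
    lies in [T l]. *)
Lemma tiling_has_marginals l : has_marginals mu (T l).
Proof.
split=> [|c A mA As]; first exact: tiling_side_gt0.
have A1 : A `<=` `[0, 1] by move=> x /As/tiling_axis_side01.
rewrite -(permuton_axis c mA A1).
pose ends : set R := [set sq c (T l)] `|` [set sq c (T l) + side (T l)].
have mends : measurable ends by apply: measurableU; exact: measurable_set1.
have ends1 : ends `<=` `[0, 1].
  have d0 := tiling_side_gt0 l.
  by move=> x hx; apply: (@tiling_axis_side01 c l); rewrite /axis_side /= in_itv/=;
    case: hx => /= ->; rewrite lexx lerDl ltW.
have e0 : mu (unit_square `&` on_axis c ends) = 0%E.
  by rewrite permuton_axis// /ends measureU0//; exact: lebesgue_measure_set1.
have mE : measurable (unit_square `&` on_axis c ends).
  by apply: measurableI; [exact: measurableX|exact: measurable_on_axis].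
have mN : measurable (~` tiles) by apply: measurableC; exact: measurable_tiles.
have N0 : mu (~` tiles) = 0%E.
  by rewrite probability_setC ?mu1 ?subee//; exact: measurable_tiles.
pose H : set (plane R) := square_set (T l) `&` on_axis c A.
have mH : measurable H.
  by apply: measurableI; [exact: measurable_square|exact: measurable_on_axis].
pose N := (~` tiles) `|` (unit_square `&` on_axis c ends).
have mNN : measurable N by exact: measurableU.
have NN0 : mu N = 0%E by exact: null_set_setU.
have sq1 : square_set (T l) `<=` unit_square by case: hT => h _ _ _; case: (h l).
have mG : measurable (unit_square `&` on_axis c A).
  by apply: measurableI; [exact: measurableX|exact: measurable_on_axis].
apply/eqP; rewrite eq_le; apply/andP; split.
  apply: le_measure; rewrite ?inE// => p [Sp Ap]; split => //; exact: sq1.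
rewrite -[leRHS](measureU0 mH mNN NN0); apply: le_measure; rewrite ?inE//.
  exact: measurableU.
move=> p [Up Ap]; have [Tp|Tp] := pselect (tiles p); last by right; left.
have [m _ Sm] := Tp.
have [e|nlm] := eqVneq l m; first by left; split; rewrite ?e.
right; right; split => //.
have := As _ Ap; rewrite /axis_side/= in_itv/= => /andP[p1 p2].
have := (square_setP _ _).1 Sm => hm; have q1 := hm true c; have q2 := hm false c.
rewrite /dist in q1 q2.
case: (tiling_sep c nlm) => s; [right|left]; apply/eqP; rewrite eq_le; apply/andP; split; lra.
Qed.

End tiling_geometry.

(** * Inversion counts *)

Section inversion_counts.
Context {R : realType} {d : measure_display} {Omega : measurableType d}.
Variables (P : probability Omega R) (n : nat) (Z : 'I_n -> {RV P >-> plane R}).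

Lemma inversions_le (I : finType) (A : I -> set (plane R)) (w : Omega) (i : 'I_n) :
  (forall j, inverted (Z i w) (Z j w) -> exists r, A r (Z j w)) ->
  #|inversions (fun j => Z j w) i|%:R <= \sum_r count_in Z (A r) w.
Proof.
move=> h; rewrite /count_in exchange_big/= -sum1_card natr_sum big_mkcond/=.
apply: ler_sum => j _; rewrite inE; case: ifPn => [/h[r Ar]|_]; last exact: sumr_ge0.
rewrite (bigD1 r)//= indicE mem_set//= lerDl; exact: sumr_ge0.
Qed.

(** Disjointness of the family prevents a sample point from being counted twice; the upper bound
    above needs only a covering. *)
Lemma inversions_ge (I : finType) (A : I -> set (plane R)) (w : Omega) (i : 'I_n) :
  (forall r q, A r q -> inverted (Z i w) q) ->
  (forall r s q, A r q -> A s q -> r = s) ->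
  \sum_r count_in Z (A r) w <= #|inversions (fun j => Z j w) i|%:R.
Proof.
move=> h1 h2; rewrite /count_in exchange_big/= -sum1_card natr_sum [leRHS]big_mkcond/=.
apply: ler_sum => j _; rewrite inE.
have [[r Ar]|no] := pselect (exists r, A r (Z j w)); last first.
  rewrite big1; first by case: ifP.
  by move=> r _; rewrite indicE memNset// => Ar; apply: no; exists r.
have -> : ((Z i w).1 - (Z j w).1) * ((Z i w).2 - (Z j w).2) < 0 by exact: (h1 r).
rewrite (bigD1 r)//= indicE mem_set//= big1 ?addr0// => s sr.
rewrite indicE memNset// => As; move/eqP : sr; apply; exact: (h2 _ _ _ As Ar).
Qed.

Lemma min_inversion_le (w : Omega) (i : 'I_n) :
  (min_inversion (fun j => Z j w) <= #|inversions (fun j => Z j w) i|)%N.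
Proof.
rewrite /min_inversion; have := mem_index_enum i.
elim: (index_enum _) => // j s IH; rewrite inE big_cons.
by case/orP => [/eqP <-|/IH h]; [exact: geq_minl|rewrite geq_min h orbT].
Qed.

Lemma min_inversion_arg (w : Omega) : (0 < n)%N ->
  exists i, min_inversion (fun j => Z j w) = #|inversions (fun j => Z j w) i|.
Proof.
move=> n0; rewrite /min_inversion.
pose N i := #|inversions (fun j => Z j w) i|.
have hle i : (N i <= n)%N by rewrite -[leqRHS]card_ord; exact: max_card.
have : forall s : seq 'I_n, s != [::] ->
    exists i, \big[minn/n]_(j <- s) N j = N i.
  elim=> // i s IH _; have [->|/IH[j hj]] := eqVneq s [::].
    by exists i; rewrite big_seq1_id /=; apply/minn_idPl.
  by rewrite big_cons hj; case: (leqP (N i) (N j)) => ij; [exists i|exists j].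
move=> /(_ (index_enum 'I_n)); apply.
by apply/eqP => e; have := mem_index_enum (Ordinal n0); rewrite e.
Qed.

End inversion_counts.

(** * Inversions inside one tile, uniformly over its points *)

Section squares_whp.
Context {R : realType} {d : nat -> measure_display}
  {Omega : forall n, measurableType (d n)}.
Variables (P : forall n, probability (Omega n) R) (mu : probability (plane R) R).
Variable Z : forall n, 'I_n -> {RV (P n) >-> plane R}.
Arguments Z : clear implicits.
Hypothesis iidZ : forall n, iid_sample mu (Z n).

(** The Chebyshev bound is at most [K n r_n / (h n r_n) ^ 2], a constant over [n r_n]. *)
Lemma whp_count_rate (r : R ^nat) (A : nat -> set (plane R)) (K h : R) :
  (forall n, measurable (A n)) -> 0 < h -> (forall n, 0 < r n) ->
  n%:R * r n @[n --> \oo] --> +oo ->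
  (\forall n \near \oo, fine (mu (A n)) <= K * r n) ->
  whp P (fun n w => `|count_in (Z n) (A n) w - n%:R * fine (mu (A n))| < h * (n%:R * r n)).
Proof.
move=> mA h0 r0 nr muK.
have nr0 : \forall n \near \oo, 0 < n%:R * r n.
  by move/cvgryPgt : nr; apply.
apply: whp_count => //.
  by apply: filterS nr0 => n ?; rewrite mulr_gt0.
have nrV : (n%:R * r n)^-1 @[n --> \oo] --> (0 : R) by apply/gtr0_cvgV0.
apply: (@squeeze_cvgr _ _ _ _ (cst 0) (fun n => K / h ^+ 2 * (n%:R * r n)^-1)).
- apply: filterS2 nr0 muK => n n0 hK.
  have p0 : 0 <= fine (mu (A n)) by rewrite fine_ge0.
  rewrite divr_ge0 ?mulr_ge0 ?exprn_ge0//= ?(ltW h0) ?(ltW (r0 n))//.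
  have hr : 0 < (h * (n%:R * r n)) ^+ 2 by rewrite exprn_gt0// mulr_gt0.
  have -> : K / h ^+ 2 / (n%:R * r n) = n%:R * (K * r n) / (h * (n%:R * r n)) ^+ 2.
    have n1 : n%:R != 0 :> R by apply/eqP => e; move: n0; rewrite e mul0r ltxx.
    by field; rewrite n1 !gt_eqF.
  by rewrite ler_wpM2r ?invr_ge0 ?(ltW hr)// ler_wpM2l.
- exact: cvg_cst.
- by rewrite -[X in _ --> X](mulr0 (K / h ^+ 2)); apply: cvgM => //; exact: cvg_cst.
Qed.

Lemma whp_count_fixed (A : set (plane R)) (h : R) : measurable A -> 0 < h ->
  whp P (fun n w => `|count_in (Z n) A w - n%:R * fine (mu A)| < h * n%:R).
Proof.
move=> mA h0.
have : whp P (fun n w => `|count_in (Z n) A w - n%:R * fine (mu A)| < h * (n%:R * 1)).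
  apply: (@whp_count_rate (cst 1) (fun=> A) (fine (mu A))) => //.
  - rewrite (_ : (fun n => _) = (fun n => n%:R)); first exact: cvgr_idn.
    by apply/funext => n; rewrite mulr1.
  - by apply: nearW => n; rewrite mulr1.
by move=> /whpS; apply; apply: nearW => n w; rewrite mulr1.
Qed.

Variable r : R ^nat.
Hypotheses (r0 : forall n, 0 < r n) (rcvg : r @ \oo --> (0 : R))
  (nr : n%:R * r n @[n --> \oo] --> +oo).

Let r_small (x y : R) : 0 < y -> \forall n \near \oo, x * r n <= y.
Proof.
move=> y0.
have : x * r n @[n --> \oo] --> (0 : R).
  by rewrite -[X in _ --> X](mulr0 x); apply: cvgM => //; exact: cvg_cst.
by move=> /cvgr_le; apply.
Qed.

Let nr0 : \forall n \near \oo, 0 < n%:R * r n.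
Proof. by move/cvgryPgt : nr; apply. Qed.

Variable S : square R.
Hypothesis hS : has_marginals mu S.

(** A point of the tile inverted with [p] is closer than [p] to the corner along one of the axes, so
    the two slabs with widths the distances of [p], rounded up to the grid, catch all of them. *)
Lemma whp_upper b (t eps : R) : 0 <= t -> 0 < eps ->
  whp P (fun n w => forall p, triangle S b ((t - eps) * r n) p ->
    exists A : bool -> set (plane R),
      (forall q, square_set S q -> inverted p q -> exists c, A c q) /\
      \sum_c count_in (Z n) (A c) w <= t * (n%:R * r n)).
Proof.
move=> t0 e0; pose h := eps / 4.
have h0 : 0 < h by rewrite divr_gt0.
(* Each of the two slabs loses at most [h] by rounding and [h] by fluctuation, in all [4 h = eps].
   The indices used are successors of integers at most [t / h], hence below [J]. *)
pose J := (Num.truncn (t / h)).+2.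
have hw : whp P (fun n w => forall cj : bool * 'I_J,
    `|count_in (Z n) (slab S b cj.1 (cj.2%:R * h * r n)) w
     - n%:R * fine (mu (slab S b cj.1 (cj.2%:R * h * r n)))| < h * (n%:R * r n)).
  apply: whp_forall => -[c j] /=.
  apply: (@whp_count_rate r (fun n => slab S b c (j%:R * h * r n)) (j%:R * h)) => //.
    by move=> n; exact: measurable_slab.
  apply: filterS (r_small (j%:R * h) hS.1) => n hn.
  by rewrite mu_slab//= hn andbT !mulr_ge0// ltW.
apply: whpS hw _.
have hsmall : \forall n \near \oo, forall j : 'I_J, j%:R * h * r n <= side S.
  apply: filter_forall => j; exact: r_small hS.1.
apply: filterS2 hsmall nr0 => n hn n0 w hw p [Sp /= hp].
have hd := (square_setP _ _).1 Sp.
have rn := r0 n.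
have hrn : 0 < h * r n by rewrite mulr_gt0.
pose j c := Num.truncn (dist b c S p / (h * r n)).
have jP c : (j c)%:R <= dist b c S p / (h * r n) < (j c).+1%:R.
  by apply: truncn_itv; rewrite divr_ge0// ltW.
have dt c : dist b c S p <= t * r n.
  have : dist b true S p + dist b false S p <= t * r n.
    by apply: le_trans hp _; rewrite ler_pM2r// lerBlDr lerDl ltW.
  by have := hd b true; have := hd b false; case: c; lra.
have jJ c : ((j c).+1 < J)%N.
  have /andP[j1 _] := jP c.
  rewrite /J ltnS -(ltr_nat R); apply: le_lt_trans (truncnS_gt _).
  by apply: le_trans j1 _; rewrite ler_pdivrMr// mulrA divfK ?gt_eqF.
pose jo c : 'I_J := Ordinal (jJ c).
exists (fun c => slab S b c ((j c).+1%:R * h * r n)); split.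
  move=> q Sq; rewrite (inverted_dist b S) => pq.
  have : exists c, dist b c S q < dist b c S p.
    have [h1|h1] := ltP (dist b true S q) (dist b true S p); first by exists true.
    have [h2|h2] := ltP (dist b false S q) (dist b false S p); first by exists false.
    by move: pq; rewrite ltNge mulr_le0 ?subr_le0.
  move=> [c qc]; exists c; split => //=; apply: (lt_trans qc).
  by have /andP[_] := jP c; rewrite ltr_pdivrMr// mulrA.
have hc c : count_in (Z n) (slab S b c ((j c).+1%:R * h * r n)) w <=
    (dist b c S p / r n + 2 * h) * (n%:R * r n).
  have := hw (c, jo c); rewrite /= mu_slab//=; last first.
    by rewrite (hn (jo c)) andbT !mulr_ge0// ltW.
  rewrite ltr_distl => /andP[_ /ltW] /le_trans; apply.
  have -> : n%:R * ((j c).+1%:R * h * r n) + h * (n%:R * r n) =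
    ((j c)%:R * h + 2 * h) * (n%:R * r n) by rewrite -natr1; ring.
  rewrite ler_wpM2r ?(ltW n0)// lerD2r.
  have /andP[j1 _] := jP c.
  by move: j1; rewrite ler_pdivlMr// ler_pdivlMr// mulrA.
rewrite big_bool/=; apply: le_trans (lerD (hc true) (hc false)) _.
rewrite -mulrDl ler_wpM2r ?(ltW n0)//.
have : (dist b true S p + dist b false S p) / r n <= t - eps by rewrite ler_pdivrMr.
by rewrite mulrDl /h; lra.
Qed.

Variables (a1 a2 : R) (phi1 phi2 : R * R -> R).
Hypotheses (hBL1 : BL_smooth (corner_measure mu S true) a1 phi1)
  (hBL2 : BL_smooth (corner_measure mu S false) a2 phi2)
  (hcb : corner_balanced (corner_measure mu S true)).

(** Outside of the corner boxes, a set [off_corner] of fixed positive mass contains of order [n]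
    inverted points, far more than [n r_n]. Inside, the two bands with widths the distances of [p],
    rounded down, are disjoint and inverted with [p]. *)
Lemma whp_lower (t eps : R) : 0 <= t -> 0 < eps ->
  whp P (fun n w => forall p, square_set S p ->
    (forall b, ~ triangle S b ((t + eps) * r n) p) ->
    exists A : bool -> set (plane R),
      [/\ forall c q, A c q -> inverted p q,
          forall c c' q, A c q -> A c' q -> c = c' &
          t * (n%:R * r n) < \sum_c count_in (Z n) (A c) w]).
Proof.
move=> t0 e0.
have d0 : 0 < side S := hS.1.
have te0 : 0 < t + eps by rewrite ltr_wpDl.
(* The bound [1 / 2] keeps [1 - kappa] positive and the mass of a corner box below [eta]; the other
   one limits the total loss to [eps / 4]. *)
pose kappa := Num.min (1 / 2) (eps / (4 * (t + eps))).
have k0 : 0 < kappa by rewrite lt_min !divr_gt0// mulr_gt0.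
have k2 : kappa <= 1 / 2 by rewrite ge_min lexx.
have kt : kappa * (t + eps) <= eps / 4.
  have -> : eps / 4 = eps / (4 * (t + eps)) * (t + eps).
    by field; rewrite gt_eqF.
  by rewrite ler_wpM2r ?(ltW te0)// ge_min lexx orbT.
have [eta1 eta10 hs1] := strip_small d0 hBL1 k0.
have [eta2 eta20 hs2] := strip_small d0 hBL2 k0.
pose eta := Num.min (Num.min eta1 eta2) (side S / 4).
have eta0 : 0 < eta by rewrite !lt_min eta10 eta20 divr_gt0.
have [e1 e2 e4] : [/\ eta <= eta1, eta <= eta2 & eta <= side S / 4].
  by rewrite !ge_min !lexx !orbT.
have hs b c s : 0 <= s <= eta -> (mu (strip S b c s eta) <= (kappa * s)%:E)%E.
  by move=> ?; case: b; [apply: hs1|apply: hs2]; rewrite ?eta0.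
have [y hy] : exists y : R, forall i, (0 < mu (off_corner S eta y i))%E.
  apply: (off_corner_gt0 hS hcb).
    by rewrite eta0/=; lra.
  move=> b; apply: le_lt_trans (hs _ _ eta _) _; rewrite ?lexx ?andbT ?(ltW eta0)//.
  by rewrite lte_fin gtr_pMl//; lra.
(* Two roundings and two fluctuations cost at most [4 h = eps / 4], and the corner boxes at most
   [eps / 4], which leaves a margin in [eps]. *)
pose h := eps / 16.
have h0 : 0 < h by rewrite divr_gt0.
pose J := (Num.truncn ((t + eps) / h)).+2.
have hw1 : whp P (fun n w => forall bcj : bool * bool * 'I_J,
    `|count_in (Z n) (band S bcj.1.1 bcj.1.2 (bcj.2%:R * h * r n) eta) w
     - n%:R * fine (mu (band S bcj.1.1 bcj.1.2 (bcj.2%:R * h * r n) eta))|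
     < h * (n%:R * r n)).
  apply: whp_forall => -[[b c] j] /=.
  apply: (@whp_count_rate r (fun n => band S b c (j%:R * h * r n) eta) (j%:R * h)) => //.
    by move=> n; exact: measurable_band.
  apply: filterS (r_small (j%:R * h) d0) => n hn.
  rewrite -lee_fin fineK ?fin_num_measure//; last exact: measurable_band.
  by apply: mu_band_le => //; rewrite hn andbT !mulr_ge0// ltW.
pose m i := fine (mu (off_corner S eta y i)).
have m0 i : 0 < m i.
  by rewrite fine_gt0// hy/= ltey_eq fin_num_measure//; exact: measurable_off_corner.
have hw2 : whp P (fun n w => forall i : bool * bool,
    `|count_in (Z n) (off_corner S eta y i) w - n%:R * m i| < m i / 2 * n%:R).
  apply: whp_forall => i; apply: whp_count_fixed; last by rewrite divr_gt0.
  exact: measurable_off_corner.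
apply: whpS (whpI hw1 hw2) _.
have hsmall : \forall n \near \oo, forall j : 'I_J, j%:R * h * r n <= eta.
  by apply: filter_forall => j; exact: r_small.
have hsmall2 : \forall n \near \oo, forall i : bool * bool, t * r n <= m i / 2.
  by apply: filter_forall => i; apply: r_small; rewrite divr_gt0.
apply: filterS3 hsmall hsmall2 nr0 => n hn hn2 n0 w [{}hw1 {}hw2] p Sp notin.
have nn0 : 0 < n%:R :> R.
  by rewrite ltr0n lt0n; apply/eqP => e; move: n0; rewrite e mul0r ltxx.
have hd := (square_setP _ _).1 Sp.
have rn := r0 n.
have hrn : 0 < h * r n by rewrite mulr_gt0.
have e3 : 0 < eta < side S / 2 by rewrite eta0/=; lra.
have [[b pb]|[i hi]] := off_corner_inv y e3 Sp; last first.
  exists (fun c => if c then off_corner S eta y i else set0); split.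
  - by case=> // q; exact: hi.
  - by case; case.
  rewrite big_bool/= /count_in [X in _ + X]big1 ?addr0 => [|j _]; last first.
    by rewrite indicE in_set0.
  have := hw2 i; rewrite ltr_distl => /andP[+ _]; apply: le_lt_trans.
  have -> : n%:R * m i - m i / 2 * n%:R = m i / 2 * n%:R by field.
  by rewrite mulrCA [leRHS]mulrC ler_wpM2l// ltW.
pose j0 c := Num.truncn (dist b c S p / (h * r n)).
have jP c : (j0 c)%:R <= dist b c S p / (h * r n) < (j0 c).+1%:R.
  by apply: truncn_itv; rewrite divr_ge0// ltW.
(* The distances of [p] may be as large as [eta], beyond the grid of order [r_n], so the widths are
   capped. A capped width alone exceeds [(t + eps) r_n]. *)
pose j c := minn (j0 c) J.-1.
have jJ c : (j c < J)%N by rewrite /j ltnS geq_minr.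
pose jo c : 'I_J := Ordinal (jJ c).
have jd c : (j c)%:R * h * r n <= dist b c S p.
  have /andP[j1 _] := jP c; rewrite -mulrA -ler_pdivlMr//.
  by apply: le_trans j1; rewrite ler_nat geq_minl.
exists (fun c => band S b c ((j c)%:R * h * r n) eta); split.
- move=> c q [Sq /= [q1 q2]]; rewrite (inverted_dist b S).
  have h1 : 0 < dist b c S p - dist b c S q.
    by rewrite subr_gt0; exact: lt_le_trans (jd c).
  have h2 : dist b (~~ c) S p - dist b (~~ c) S q < 0.
    by rewrite subr_lt0; exact: le_lt_trans (pb _) q2.
  by case: c h1 h2 {q1 q2} => /= h1 h2; [rewrite pmulr_rlt0|rewrite nmulr_rlt0].
- have dis q : band S b true ((j true)%:R * h * r n) eta q ->
      band S b false ((j false)%:R * h * r n) eta q -> False.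
    move=> [_ /= [q1 _]] [_ /= [_ q2]].
    by have := lt_trans q2 q1; rewrite ltNge (le_trans (jd true) (pb true)).
  by case=> -[] // q h1 h2; exfalso; apply: (dis q).
have hc c : ((j c)%:R * h * (1 - kappa) - h) * (n%:R * r n) <=
    count_in (Z n) (band S b c ((j c)%:R * h * r n) eta) w.
  have := hw1 (b, c, jo c); rewrite /= ltr_distl => /andP[/ltW + _]; apply: le_trans.
  have jr0 : 0 <= (j c)%:R * h * r n by rewrite !mulr_ge0// ltW.
  have jre : 0 <= (j c)%:R * h * r n <= eta by rewrite jr0 (hn (jo c)).
  have jrs : 0 <= (j c)%:R * h * r n <= side S.
    by rewrite jr0/= (le_trans (hn (jo c)))//; lra.
  have := mu_band_ge hS jrs (hs b c _ jre).
  rewrite -[X in (_ <= X)%E]fineK ?fin_num_measure//; last exact: measurable_band.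
  rewrite lee_fin => hb; rewrite mulrBl lerD2r.
  have -> : (j c)%:R * h * (1 - kappa) * (n%:R * r n) =
    n%:R * ((j c)%:R * h * r n - kappa * ((j c)%:R * h * r n)) by ring.
  by rewrite ler_wpM2l.
rewrite big_bool/=; apply: lt_le_trans (lerD (hc true) (hc false)).
rewrite -mulrDl ltr_pM2r//.
have tr : t + eps < dist b true S p / r n + dist b false S p / r n.
  rewrite -mulrDl ltr_pdivlMr// ltNge; apply/negP => le.
  by apply: (notin b); split.
have j1 c : dist b c S p / r n < (j0 c)%:R * h + h.
  have /andP[_] := jP c; rewrite ltr_pdivrMr// -natr1 => hh.
  by rewrite ltr_pdivrMr//; apply: lt_le_trans hh _; rewrite le_eqVlt; apply/orP; left; apply/eqP; ring.
have jge0 c : 0 <= (j c)%:R * h by rewrite mulr_ge0// ltW.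
have Jte : t + eps < J.-1%:R * h.
  by rewrite -ltr_pdivrMr//; exact: truncnS_gt.
have jmin c : (j c)%:R * h = Num.min ((j0 c)%:R * h) (J.-1%:R * h).
  rewrite /j natr_min minr_pMl// ltW//.
(* Either some width is capped and suffices by [Jte], or both are rounded distances whose sum misses
   that of [p] by less than [2 h], and [p] is outside of the triangle. *)
have : t + eps - 2 * h < (j true)%:R * h + (j false)%:R * h.
  have := jge0 true; have := jge0 false; rewrite !jmin.
  have := j1 true; have := j1 false.
  case: (leP ((j0 true)%:R * h)); case: (leP ((j0 false)%:R * h)); lra.
set X := _ + (j false)%:R * h => hX.
have -> : (j true)%:R * h * (1 - kappa) - h + ((j false)%:R * h * (1 - kappa) - h) =
  X * (1 - kappa) - 2 * h by rewrite /X; ring.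
have hX' : (t + eps - 2 * h) * (1 - kappa) < X * (1 - kappa).
  by rewrite ltr_pM2r//; lra.
apply: lt_le_trans (lerD (ltW hX') (lexx _)).
have kh : 0 <= kappa * h by rewrite mulr_ge0// ltW.
rewrite /h in kh *; lra.
Qed.

End squares_whp.

(** * Rayleigh laws and the Poisson limit *)

Section rayleigh_law.
Context {R : realType}.

Lemma uniform_prob01_itv (c : R) : 0 < c <= 1 ->
  uniform_prob (@ltr01 R) `]0, c[%classic = c%:E.
Proof.
move=> /andP[c0 c1]; rewrite /uniform_prob.
rewrite (eq_integral (cst 1%:E)); last first.
  move=> x; rewrite inE/= in_itv/= => /andP[x0 xc].
  by rewrite /uniform_pdf (ltW x0) (ltW (lt_le_trans xc c1))/= subr0 invr1.
rewrite integral_cst// mul1e.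
transitivity (lebesgue_measure (`]0, c[%classic : set R)) => //.
by rewrite lebesgue_measure_itv/= lte_fin c0 oppr0 adde0.
Qed.

(* The law of [(- ln U / b) ^ (1 / a)] for a uniform variable [U]. *)
Lemma rayleigh_exists (a b : R) : 0 < a -> 0 < b ->
  exists nu : probability R R, rayleigh a%:E b nu.
Proof.
move=> a0 b0.
(* The maximum keeps the base nonnegative for [x > 1]. For [x <= 0] the convention [ln x = 0] gives
   [h x = 0], so such [x] never satisfy [t < h x]. *)
pose h (x : R) : R := (Num.max (- ln x) 0 / b) `^ a^-1.
have mh : measurable_fun [set: R] h.
  have mg : measurable_fun [set: R] (fun x : R => Num.max (- ln x) 0 / b).
    apply: measurable_funM => //; apply: measurable_maxr => //.
    by apply: measurable_funN; exact: measurable_ln.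
  exact: (measurableT_comp (@measurable_powR R a^-1) mg).
have mh' : measurable_fun [set: measurableTypeR R] (h : measurableTypeR R -> R).
  exact: mh.
pose X : {mfun measurableTypeR R >-> R} :=
  HB.pack (h : measurableTypeR R -> R) (isMeasurableFun.Build _ _ (measurableTypeR R) R h mh').
pose U : probability (measurableTypeR R) R := uniform_prob (@ltr01 R).
have h0 x : 0 <= h x by rewrite powR_ge0.
exists (distribution U X); split.
  rewrite /distribution /pushforward/= (_ : _ @^-1` _ = setT).
    exact: (@probability_setT _ _ _ U).
  by apply/seteqP; split => x //= _; rewrite in_itv/= h0.
move=> t t0; rewrite /distribution /pushforward/=.
have bt0 : 0 <= b * t `^ a by rewrite mulr_ge0 ?powR_ge0// ltW.
rewrite (_ : _ @^-1` _ = `]0, expR (- (b * t `^ a))[%classic).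
  apply: uniform_prob01_itv; rewrite expR_gt0/= -[leRHS]expR0 ler_expR.
  by rewrite oppr_le0.
have hE (x : R) : (t < h x) = (b * t `^ a < - ln x).
  rewrite /h; set y := - ln x.
  have m0 : 0 <= Num.max y 0 / b by rewrite divr_ge0 ?le_max ?lexx ?orbT// ltW.
  have hp : Num.max y 0 / b = ((Num.max y 0 / b) `^ a^-1) `^ a.
    by rewrite -powRrM mulVf ?gt_eqF// powRr1.
  have -> : (t < (Num.max y 0 / b) `^ a^-1) = (t `^ a < Num.max y 0 / b).
    rewrite [in RHS]hp; apply/idP/idP => [tx|].
      by apply: gt0_ltr_powR; rewrite ?nnegrE ?powR_ge0.
    by rewrite ltNge => h1; rewrite ltNge; apply: contra h1 => h1;
      apply: ge0_ler_powR; rewrite ?nnegrE ?powR_ge0// ltW.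
  rewrite ltr_pdivlMr// mulrC lt_max; apply/orP/idP => [[//|h1]|]; last by left.
  by move: h1; rewrite ltNge bt0.
apply/seteqP; split => x /=; rewrite !in_itv/= !andbT hE.
  move=> bx; have x0 : 0 < x.
    rewrite ltNge; apply/negP => x0; move: bx.
    by rewrite ln0// oppr0 ltNge bt0.
  by rewrite x0/= -[X in X < _](lnK x0) ltr_expR ltrNr.
by move=> /andP[x0 xe]; rewrite ltrNr -ltr_expR (lnK x0).
Qed.

Lemma rayleigh_cdf (a b t : R) (nu : probability R R) :
  0 < a -> rayleigh a%:E b nu ->
  nu `]-oo, t]%classic = (if t < 0 then 0 else 1 - expR (- (b * t `^ a)))%:E.
Proof.
move=> a0 [nu0 h].
have nuC : nu `]-oo, t]%classic = (1 - nu `]t, +oo[%classic)%E.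
  rewrite -(probability_setC nu)//; congr (nu _).
  by apply/seteqP; split => x /=; rewrite !in_itv/= andbT => h1;
    [apply/negP; rewrite -leNgt|rewrite leNgt; exact/negP].
case: ifPn => [t0|].
  apply/eqP; rewrite -measure_le0 -(@subee _ 1%E)// -[X in (_ <= 1 - X)%E]nu0.
  rewrite -(probability_setC nu)//; apply: le_measure; rewrite ?inE//.
    exact: measurableC.
  move=> x /=; rewrite !in_itv/= andbT => xt; apply/negP; rewrite -ltNge.
  exact: le_lt_trans t0.
by rewrite -leNgt => t0; rewrite nuC h.
Qed.

Lemma dirac_probability (b : R) : exists nu : probability R R, rayleigh +oo%E b nu.
Proof.
by exists (dirac b).
Qed.

Lemma rayleigh_oo_cdf (b t : R) (nu : probability R R) : rayleigh +oo%E b nu ->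
  nu `]-oo, t]%classic = (if b <= t then 1 else 0)%:E.
Proof.
by move=> ->//; rewrite diracE mem_setE in_itv/=; case: ifP.
Qed.

(** The jump at [b] exempts [t = b] from the convergence to be proved. *)
Lemma rayleigh_oo_discontinuous (b : R) (nu : probability R R) : rayleigh +oo%E b nu ->
  ~ {for b, continuous (fun s : R => nu `]-oo, s]%classic)}.
Proof.
move=> hnu; rewrite /prop_for /continuous_at (rayleigh_oo_cdf _ hnu) lexx => h.
have : \forall s \near b, (0 < nu `]-oo, s]%classic)%E.
  have := h [set x | (0 < x)%E]; apply.
  by apply: open_nbhs_nbhs; split; [exact: open_ereal_gt_ereal|rewrite /= lte_fin].
case=> e /= e0 /(_ (b - e / 2)).
rewrite /ball_/= opprB addrC subrK ger0_norm; last by rewrite divr_ge0// ltW.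
rewrite ltr_pdivrMr// ltr_pMr// ltr1n => /(_ isT).
by rewrite (rayleigh_oo_cdf _ hnu) lerBrDr gerDl leNgt divr_gt0// ltxx.
Qed.

End rayleigh_law.

Lemma cvg_natrV (R : realType) : n%:R^-1 @[n --> \oo] --> (0 : R).
Proof.
by apply/gtr0_cvgV0; [exists 1%N => // n n0; rewrite /= ltr0n|exact: cvgr_idn].
Qed.

Section poisson_limit.
Context {R : realType}.

(** The inequality [1 + y <= exp y] at [y = - x] and at [y = x / (1 - x)] squeezes [(1 - x) ^ n]
    between [exp (- n x / (1 - x))] and [exp (- n x)]. *)
Lemma cvg_void_probability (x : R ^nat) (B : R) :
  (forall n, 0 <= x n <= 1) -> n%:R * x n @[n --> \oo] --> B ->
  (1 - x n) ^+ n @[n --> \oo] --> expR (- B).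
Proof.
move=> x01 nx.
have x_0 : x @ \oo --> (0 : R).
  have nV := @cvg_natrV R.
  have : n%:R^-1 * (n%:R * x n) @[n --> \oo] --> 0 * B by exact: cvgM.
  rewrite mul0r; apply: cvg_trans; apply: near_eq_cvg; exists 1%N => // n /= n0.
  by rewrite mulKf// pnatr_eq0 -lt0n.
apply: (@squeeze_cvgr _ _ _ _ (fun n => expR (- (n%:R * x n) / (1 - x n)))
   (fun n => expR (- (n%:R * x n)))).
- have : \forall n \near \oo, x n < 1 by move/cvgr_lt : x_0; apply.
  apply: filterS => n xn1; have /andP[xn0 _] := x01 n.
  apply/andP; split; last first.
    rewrite -mulrN expRM_natl lerXn2r ?nnegrE ?expR_ge0 ?subr_ge0 ?(ltW xn1)//.
    exact: expR_ge1Dx.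
  have y0 : 0 < 1 - x n by rewrite subr_gt0.
  rewrite mulNr -mulrA -mulrN expRM_natl lerXn2r ?nnegrE ?expR_ge0 ?(ltW y0)//.
  rewrite expRN -[leRHS]invrK lef_pV2 ?posrE ?expR_gt0 ?invr_gt0//.
  have E : (1 - x n)^-1 = 1 + x n / (1 - x n) by field; rewrite gt_eqF.
  by rewrite [leLHS]E; exact: expR_ge1Dx.
- have c1 : - (n%:R * x n) / (1 - x n) @[n --> \oo] --> - B / (1 - 0).
    apply: cvgM; first exact: cvgN.
    apply: cvgV; first by rewrite subr0.
    by apply: cvgB => //; exact: cvg_cst.
  rewrite subr0 divr1 in c1.
  by apply: continuous_cvg c1; exact: continuous_expR.
- by apply: continuous_cvg; [exact: continuous_expR|exact: cvgN].
Qed.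

End poisson_limit.

(** * Measurability of the minimal inversion *)

Section measurable_min_inversion.
Context {R : realType} {d : measure_display} {Omega : measurableType d}.
Variables (P : probability Omega R) (n : nat) (Z : 'I_n -> {RV P >-> plane R}).

Lemma measurable_finite_valued (F : finType) (g : Omega -> F) (Q : F -> Prop) :
  (forall f, measurable (g @^-1` [set f])) -> measurable [set w | Q (g w)].
Proof.
move=> mg; rewrite (_ : [set w | _] = \bigcup_(f in [set f | Q f]) (g @^-1` [set f])).
  by apply: fin_bigcup_measurable => //; exact: finite_finset.
apply/seteqP; split => w /=; first by move=> Qw; exists (g w).
by case=> f /= Qf gf; rewrite gf.
Qed.

Lemma measurable_inverted i j : measurable [set w | inverted (Z i w) (Z j w)].
Proof.
have m1 l : measurable_fun setT (fun w => (Z l w).1 : R).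
  by apply: (measurableT_comp measurable_fst); exact: (@measurable_funPT _ _ _ _ (Z l)).
have m2 l : measurable_fun setT (fun w => (Z l w).2 : R).
  by apply: (measurableT_comp measurable_snd); exact: (@measurable_funPT _ _ _ _ (Z l)).
rewrite (_ : [set w | _] = setT `&` (fun w => ((Z i w).1 - (Z j w).1) *
    ((Z i w).2 - (Z j w).2) : R) @^-1` `]-oo, 0[).
  by apply: measurable_funM => //; exact: measurable_funB.
by rewrite setTI; apply/seteqP; split => w; rewrite /= in_itv.
Qed.

(** The minimum is a function of the finite Boolean table of inverted pairs, each entry of which is
    a measurable event. *)
Lemma measurable_min_inversion (Q : nat -> Prop) :
  measurable [set w | Q (min_inversion (fun i => Z i w))].
Proof.
pose g w : {ffun 'I_n * 'I_n -> bool} := [ffun ij => inverted (Z ij.1 w) (Z ij.2 w)].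
pose F (f : {ffun 'I_n * 'I_n -> bool}) :=
  \big[minn/n]_(i < n) #|[set j | f (i, j)]%SET|.
have E w : min_inversion (fun i => Z i w) = F (g w).
  rewrite /min_inversion /F; apply: eq_bigr => i _; apply: eq_card => j.
  by rewrite !inE ffunE.
have -> : [set w | Q (min_inversion (fun i => Z i w))] = [set w | (Q \o F) (g w)].
  by apply/seteqP; split => w /=; rewrite E.
apply: measurable_finite_valued => f.
rewrite (_ : g @^-1` [set f] = \bigcap_(ij in [set: 'I_n * 'I_n])
    [set w | inverted (Z ij.1 w) (Z ij.2 w) = f ij]).
  apply: fin_bigcap_measurable; first exact: finite_finset.
  move=> [i j] _ /=; case: (f (i, j)); first exact: measurable_inverted.
  rewrite (_ : [set w | _] = ~` [set w | inverted (Z i w) (Z j w)]).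
    by apply: measurableC; exact: measurable_inverted.
  by apply/seteqP; split => w /=; [move=> ->|move/negP/negbTE].
apply/seteqP; split => w /=; first by move=> <- ij _; rewrite /= ffunE.
by move=> h; apply/ffunP => ij; rewrite ffunE h.
Qed.

End measurable_min_inversion.

Lemma powR_cvg0 (R : realType) (u : R ^nat) (p : R) : 0 < p ->
  (forall n, 0 < u n) -> u @ \oo --> (0 : R) -> u n `^ p @[n --> \oo] --> (0 : R).
Proof.
move=> p0 u0 u_0; apply/cvgr0Pnorm_lt => e e0.
have : \forall n \near \oo, u n < e `^ p^-1.
  by move/cvgr_lt : u_0; apply; rewrite powR_gt0.
apply: filterS => n h; rewrite ger0_norm ?powR_ge0//.
have -> : e = (e `^ p^-1) `^ p by rewrite -powRrM mulVf ?gt_eqF// powRr1// ltW.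
by apply: gt0_ltr_powR; rewrite ?nnegrE ?powR_ge0// ltW.
Qed.

(** * The scale of the corner triangles *)

Section corner_scale.
Context {R : realType}.
Variable alpha : R.
Hypothesis alpha0 : 0 < alpha.

(* [maxn n 1] makes the scale positive at [n = 0] too. *)
Definition inv_size (n : nat) : R := (maxn n 1)%:R^-1.
Definition corner_scale (n : nat) : R := inv_size n `^ (alpha + 1)^-1.

Lemma inv_size_gt0 n : 0 < inv_size n.
Proof. by rewrite invr_gt0 ltr0n leq_max orbT. Qed.

Lemma inv_sizeE n : (0 < n)%N -> inv_size n = n%:R^-1.
Proof. by move=> n0; rewrite /inv_size (maxn_idPl _). Qed.

Lemma cvg_inv_size : inv_size @ \oo --> (0 : R).
Proof.
by apply: cvg_trans (@cvg_natrV R); apply: near_eq_cvg; exists 1%N => // n /= n0; rewrite inv_sizeE.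
Qed.

Lemma corner_scale_gt0 n : 0 < corner_scale n.
Proof. by apply: powR_gt0; exact: inv_size_gt0. Qed.

Lemma cvg_corner_scale : corner_scale @ \oo --> (0 : R).
Proof.
apply: powR_cvg0; [by rewrite invr_gt0 addr_gt0|exact: inv_size_gt0|exact: cvg_inv_size].
Qed.

Lemma size_corner_scale n : (0 < n)%N ->
  n%:R * corner_scale n = n%:R `^ (alpha / (alpha + 1)).
Proof.
move=> n0; have n0' : 0 < n%:R :> R by rewrite ltr0n.
rewrite /corner_scale inv_sizeE// -(powR_inv1 (ltW n0')) -powRrM.
rewrite -[X in X * _](powRr1 (ltW n0')) -powRD; last by rewrite (gt_eqF n0') implybT.
by congr (_ `^ _); field; rewrite gt_eqF// addr_gt0.
Qed.

Lemma cvg_size_corner_scale : n%:R * corner_scale n @[n --> \oo] --> +oo.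
Proof.
have n0 : \forall n \near \oo, 0 < n%:R * corner_scale n.
  by exists 1%N => // n /= n0; rewrite mulr_gt0 ?ltr0n ?corner_scale_gt0.
apply/gtr0_cvgV0 => //.
have p0 : 0 < alpha / (alpha + 1) by rewrite divr_gt0// addr_gt0.
apply: cvg_trans (powR_cvg0 p0 inv_size_gt0 cvg_inv_size).
apply: near_eq_cvg; exists 1%N => // n /= n1; have n1' : 0 < n%:R :> R by rewrite ltr0n.
rewrite /= size_corner_scale// inv_sizeE// -(powR_inv1 (ltW n1')) -powRrM mulN1r.
by rewrite powRN.
Qed.

Variables (mu : probability (plane R) R) (S : square R) (b : bool).
Variables (a : R) (phi : R * R -> R).
Hypotheses (d0 : 0 < side S) (hBL : BL_smooth (corner_measure mu S b) a phi).

Definition Delta_mass (f : R * R -> R) : R := \int[lebesgue2]_(p in Delta) f p.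

Lemma Delta_massE : (\int[lebesgue2]_(p in Delta) (phi p)%:E = (Delta_mass phi)%:E)%E.
Proof.
have lty := BL_smooth_integral_fin hBL measurable_Delta Delta_unit_square.
rewrite /Delta_mass /Rintegral fineK// ge0_fin_numE//.
exact/ltW/(BL_smooth_Delta_gt0 hBL).
Qed.

(** At size [s = c r_n] the mass is of order [s ^ (a + 1)] and
    [n s ^ (alpha + 1) = c ^ (alpha + 1)]; the remaining factor [s ^ (a - alpha)] removes the
    corners with [a > alpha]. *)
Lemma cvg_triangle_mass (c : R) : 0 < c -> alpha <= a ->
  n%:R * fine (mu (triangle S b (c * corner_scale n))) @[n --> \oo] -->
    c `^ (alpha + 1) * ((if a == alpha then side S `^ (- alpha) else 0) * Delta_mass phi).
Proof.
move=> c0 aa; pose s n := c * corner_scale n.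
have s0 n : 0 < s n by rewrite mulr_gt0// corner_scale_gt0.
have s_0 : s @ \oo --> (0 : R).
  by rewrite -[X in _ --> X](mulr0 c); apply: cvgM; [exact: cvg_cst|exact: cvg_corner_scale].
have := triangle_limit d0 hBL s0 s_0; rewrite Delta_massE -EFinM => /fine_cvgP[_ h].
have hs : s n `^ (a - alpha) @[n --> \oo] --> (if a == alpha then 1 else 0 : R).
  case: eqVneq => [->|na].
    by apply: cvg_near_cst; apply: nearW => n; rewrite subrr powRr0.
  by apply: powR_cvg0 => //; rewrite subr_gt0 lt_neqAle eq_sym na.
have -> : (if a == alpha then side S `^ (- alpha) else 0) * Delta_mass phi =
    (if a == alpha then 1 else 0) * (side S `^ (- a) * Delta_mass phi).
  by case: eqVneq => [->|_]; rewrite ?mul1r ?mul0r.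
have hc : (c `^ (alpha + 1)) @[n --> \oo] --> c `^ (alpha + 1) by exact: cvg_cst.
apply: cvg_trans (cvgM hc (cvgM hs h)).
apply: near_eq_cvg; exists 1%N => // n /= n1; have n1' : 0 < n%:R :> R by rewrite ltr0n.
rewrite fineM ?fin_num_measure//=; last exact: measurable_triangle.
rewrite !mulrA; congr (_ * _).
rewrite -mulrA -powRD; last by rewrite (gt_eqF (s0 n)) implybT.
have -> : a - alpha + - (a + 1) = - (alpha + 1) by ring.
rewrite /s powRM ?(ltW c0) ?(ltW (corner_scale_gt0 n))// mulrA -powRD; last first.
  by rewrite (gt_eqF c0) implybT.
rewrite subrr powRr0 mul1r /corner_scale -powRrM mulrN mulVf ?gt_eqF ?addr_gt0//.
by rewrite inv_sizeE// powR_inv1 ?invrK// invr_ge0.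
Qed.

End corner_scale.

(** A null triangle would make all smaller ones null, against the positive limit of their rescaled
    masses. *)
Lemma triangle_mass_gt0 (R : realType) (mu : probability (plane R) R) (S : square R)
    (b : bool) (a : R) (phi : R * R -> R) : 0 < side S ->
  BL_smooth (corner_measure mu S b) a phi ->
  forall s : R, 0 < s -> (0 < mu (triangle S b s))%E.
Proof.
move=> d0 hBL s s0; rewrite lt0e measure_ge0 andbT; apply/eqP => mu0.
have := triangle_limit d0 hBL (@inv_size_gt0 R) (@cvg_inv_size R).
rewrite (Delta_massE hBL) -EFinM => h.
have h0 : ((inv_size n `^ (- (a + 1)))%:E * mu (triangle S b (inv_size n)))%E
    @[n --> \oo] --> (0 : \bar R).
  apply: cvg_near_cst.
  have : \forall n \near \oo, inv_size n < s by move/cvgr_lt : (@cvg_inv_size R); apply.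
  apply: filterS => n ns; apply/eqP; rewrite mule_eq0; apply/orP; right.
  rewrite -measure_le0 -[leRHS]mu0; apply: le_measure; rewrite ?inE; try exact: measurable_triangle.
  by move=> p [Sp /= ps]; split => //=; exact: le_trans ps (ltW ns).
have e := cvg_unique (@ereal_hausdorff R) h h0.
have := BL_smooth_Delta_gt0 hBL; rewrite (Delta_massE hBL) lte_fin => D0.
have : 0 < side S `^ (- a) * Delta_mass phi by rewrite mulr_gt0// powR_gt0.
by rewrite -lte_fin e ltxx.
Qed.

Lemma null_bigcup_fin (d : measure_display) (X : measurableType d) (R : realType)
    (mu : {measure set X -> \bar R}) (I : finType) (F : I -> set X) :
  (forall i, measurable (F i)) -> (forall i, mu (F i) = 0%E) ->
  mu (\bigcup_i F i) = 0%E.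
Proof.
move=> mF F0.
have -> : \bigcup_i F i = \big[setU/set0]_(i <- index_enum I) F i.
  rewrite -bigcup_seq; apply/seteqP; split => x [i _ Fi]; exists i => //=.
  exact: mem_index_enum.
have [] : measurable (\big[setU/set0]_(i <- index_enum I) F i) /\
    mu (\big[setU/set0]_(i <- index_enum I) F i) = 0%E; last by [].
elim/big_ind : _ => [|A B [mA A0] [mB B0]|i _]; last by split.
  by split; [exact: measurable0|exact: measure0].
by split; [exact: measurableU|exact: null_set_setU].
Qed.

(** * Continuity of the limiting tail *)

Section tail_continuity.
Context {R : realType}.
Variables (B p : R).
Hypothesis p0 : 0 < p.

Let tail (y : R) : R := expR (- (y * B)).

Let tail_near (y e : R) : 0 < e -> exists2 del : R, 0 < del &
  forall z, `|y - z| < del -> `|tail y - tail z| <= e.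
Proof.
move=> e0; have : tail z @[z --> y] --> tail y.
  have h : - (z * B) @[z --> y] --> - (y * B).
    by apply: cvgN; apply: cvgM => //; exact: cvg_cst.
  exact: (continuous_cvg _ (@continuous_expR R (- (y * B))) h).
by move=> /cvgrPdist_le/(_ e e0)[del /= del0 h]; exists del => // z; exact: h.
Qed.

(** Moving [t ^ p] rather than [t] reduces the claim to continuity of the exponential. The strict
    gap [s - t] is the margin spent in the inversion estimates. *)
Lemma weibull_tail_right (t e : R) : 0 <= t -> 0 < e ->
  exists2 s, t < s & tail (t `^ p) - e <= tail (s `^ p).
Proof.
move=> t0 e0; have [del del0 h] := tail_near (t `^ p) e0.
have pI : 0 < p^-1 by rewrite invr_gt0.
have y0 : 0 <= t `^ p by rewrite powR_ge0.
exists ((t `^ p + del / 2) `^ p^-1).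
  have tE : t = (t `^ p) `^ p^-1 by rewrite -powRrM divff ?gt_eqF// powRr1.
  have d2 : 0 < del / 2 by rewrite divr_gt0.
  rewrite [X in X < _]tE.
  by apply: gt0_ltr_powR; rewrite ?nnegrE ?addr_ge0 ?ltrDl// ltW.
rewrite -powRrM mulVf ?gt_eqF// powRr1; last by rewrite addr_ge0// ltW// divr_gt0.
have := h (t `^ p + del / 2); rewrite opprD addrA subrr sub0r normrN gtr0_norm ?divr_gt0//.
rewrite ltr_pdivrMr// ltr_pMr// ltr1n => /(_ isT); rewrite ler_norml => /andP[_]; lra.
Qed.

Lemma weibull_tail_left (t e : R) : 0 < t -> 0 < e ->
  exists s, [/\ 0 < s, s < t & tail (s `^ p) <= tail (t `^ p) + e].
Proof.
move=> t0 e0; have [del del0 h] := tail_near (t `^ p) e0.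
have pI : 0 < p^-1 by rewrite invr_gt0.
have y0 : 0 < t `^ p by rewrite powR_gt0.
have [z [z0 zt zd]] : exists z : R, [/\ 0 < z, z < t `^ p & t `^ p - z < del].
  (* The second term keeps [z] positive when [del] is large. *)
  exists (Num.max (t `^ p - del / 2) (t `^ p / 2)); split.
  - by rewrite lt_max (divr_gt0 y0)// orbT.
  - by rewrite gt_max ltrBlDr ltrDl divr_gt0//= ltr_pdivrMr// ltr_pMr// ltr1n.
  - rewrite ltrBlDr -ltrBlDl lt_max; apply/orP; left.
    by rewrite ltrD2l ltrN2 ltr_pdivrMr// ltr_pMr// ltr1n.
exists (z `^ p^-1); split; first exact: powR_gt0.
  have tE : t = (t `^ p) `^ p^-1 by rewrite -powRrM divff ?gt_eqF// powRr1// ltW.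
  rewrite [X in _ < X]tE.
  by apply: gt0_ltr_powR; rewrite ?nnegrE// ltW.
rewrite -powRrM mulVf ?gt_eqF// powRr1 ?(ltW z0)//.
have := h z; rewrite gtr0_norm ?subr_gt0// => /(_ zd); rewrite ler_norml => /andP[+ _].
by lra.
Qed.

End tail_continuity.

(** * Samples of a tile-standard permuton *)

Section tiled_sample.
Context {R : realType} {k : nat}.
Variables (T : 'I_k -> square R) (mu : probability (plane R) R).
Hypotheses (hT : tiling T) (hmu : permuton mu) (mu1 : mu (tiles T) = 1%E).
Variables (a : 'I_k -> bool -> R) (f : 'I_k -> bool -> R * R -> R).
Hypotheses (hBL : forall l b, BL_smooth (corner_measure mu (T l) b) (a l b) (f l b))
  (hcb : forall l, corner_balanced (corner_measure mu (T l) true)).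
Context {d : nat -> measure_display} {Omega : forall n, measurableType (d n)}.
Variables (P : forall n, probability (Omega n) R).
Variable Z : forall n, 'I_n -> {RV (P n) >-> plane R}.
Arguments Z : clear implicits.
Hypothesis iidZ : forall n, iid_sample mu (Z n).

Let hS l : has_marginals mu (T l) := tiling_has_marginals hT hmu mu1 l.
Let side0 l : 0 < side (T l) := tiling_side_gt0 hT l.

Lemma whp_inner_tiles :
  whp P (fun n w => forall i : 'I_n, exists l, inner (T l) (Z n i w)).
Proof.
pose U : set (plane R) := \bigcup_l inner (T l).
have mU : measurable U.
  by apply: fin_bigcup_measurable => // l _; exact: measurable_inner.
have mUl l : measurable (square_set (T l) `\` inner (T l) : set (plane R)).
  by apply: measurableD; [exact: measurable_square|exact: measurable_inner].
suff U1 : mu U = 1%E.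
  apply: whpS (whp_all_in iidZ mU U1) _.
  by apply: nearW => n w h i; have [l _ hl] := h i; exists l.
pose N : set (plane R) := \bigcup_l (square_set (T l) `\` inner (T l)).
have mN : measurable N by exact: fin_bigcup_measurable.
have N0 : mu N = 0%E.
  apply: null_bigcup_fin => // l.
  rewrite measureD//; last first.
  - apply: (@le_lt_trans _ _ 1%E); last exact: ltry.
    by apply: probability_le1; exact: measurable_square.
  - exact: measurable_inner.
  - exact: measurable_square.
  rewrite setIidr; last exact: inner_sub.
  transitivity ((side (T l))%:E - (side (T l))%:E)%E; last by rewrite -EFinB subrr.
  by congr (_ - _)%E; [exact: (mu_square (hS l))|exact: (mu_inner (hS l))].
apply/eqP; rewrite eq_le probability_le1//=.
rewrite -[leLHS]mu1 -(measureU0 mU mN N0); apply: le_measure; rewrite ?inE.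
- exact: measurable_tiles.
- exact: measurableU.
move=> p [l _ Sp]; have [ip|ip] := pselect (inner (T l) p); first by left; exists l.
by right; exists l.
Qed.

Lemma whp_inner_count (h : 'I_k -> R) : (forall m, 0 < h m) ->
  whp P (fun n w => forall m, `|count_in (Z n) (inner (T m)) w - n%:R * side (T m)| < h m * n%:R).
Proof.
move=> h0; apply: whp_forall => m.
apply: whpS (whp_count_fixed iidZ (measurable_inner (T m)) (h0 m)) _.
by apply: nearW => n w; rewrite (mu_inner (hS m)).
Qed.

Lemma splittingP l : reflect (forall m, ~~ inverted_squares T l m) (l \in splittings T).
Proof.
rewrite /splittings inE; apply: (iffP eqP) => [h m|h].
  by rewrite -(perm_inversionsE hT) h inE.
by apply/setP => m; rewrite perm_inversionsE// (negbTE (h m)) inE.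
Qed.

Lemma not_splittingP l : l \notin splittings T -> exists m, inverted_squares T l m.
Proof.
move=> h; apply/existsP; apply: contraNT h => /existsPn h.
exact/splittingP.
Qed.

(** * Finite exponent: hitting the corners of the splittings *)

Section finite_exponent.
Variable alpha : R.
Hypotheses (alpha0 : 0 < alpha)
  (alpha_le : forall l b, l \in splittings T -> alpha <= a l b).

Let r := corner_scale alpha.
Let r0 n : 0 < r n := corner_scale_gt0 alpha n.
Let rcvg : r @ \oo --> (0 : R) := cvg_corner_scale alpha0.
Let nr : n%:R * r n @[n --> \oo] --> +oo := cvg_size_corner_scale alpha0.

(** Restricting to the open tile makes these sets disjoint for distinct [l] without changing their
    mass. *)
Definition split_corner l s : set (plane R) :=
  inner (T l) `&` (triangle (T l) true s `|` triangle (T l) false s).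

Definition split_corners s : set (plane R) :=
  \bigcup_(l in [set l | l \in splittings T]) split_corner l s.

Lemma measurable_split_corner l s : measurable (split_corner l s).
Proof.
apply: measurableI; first exact: measurable_inner.
by apply: measurableU; exact: measurable_triangle.
Qed.

Lemma measurable_split_corners s : measurable (split_corners s).
Proof.
apply: fin_bigcup_measurable; first exact: finite_finset.
by move=> l _; exact: measurable_split_corner.
Qed.

(** A point of a splitting tile has inversions only within its own tile, where [whp_upper]
    applies. *)
Lemma whp_few_inversions (t eps : R) : 0 <= t -> 0 < eps ->
  whp P (fun n w => (exists i, split_corners ((t - eps) * r n) (Z n i w)) ->
    (min_inversion (fun i => Z n i w))%:R <= t * (n%:R * r n)).
Proof.
move=> t0 e0.
have hu : whp P (fun n w => forall lb : 'I_k * bool,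
  forall p, triangle (T lb.1) lb.2 ((t - eps) * r n) p ->
    exists A : bool -> set (plane R),
      (forall q, square_set (T lb.1) q -> inverted p q -> exists c, A c q) /\
      \sum_c count_in (Z n) (A c) w <= t * (n%:R * r n)).
  by apply: whp_forall => -[l b]; exact: whp_upper.
apply: whpS (whpI hu whp_inner_tiles) _; apply: nearW => n w [{}hu hi] [i [l /= lD [_ tri]]].
have [b {}tri] : exists b, triangle (T l) b ((t - eps) * r n) (Z n i w).
  by case: tri; [exists true|exists false].
have [A [hA cA]] := hu (l, b) _ tri.
apply: le_trans cA; apply: (le_trans _ (inversions_le (A := A) (i := i) _)).
  by rewrite ler_nat; exact: min_inversion_le.
move=> j ij; apply: hA => //=.
have [m /inner_sub Sj] := hi j.
have [->//|nlm] := eqVneq l m.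
have := inverted_squares_of_points hT nlm tri.1 Sj ij.
by have /splittingP/(_ m)/negbTE -> := lD.
Qed.

(** In a splitting tile this is [whp_lower]. In any other tile, a whole inverted tile [T m] holds
    more than [n * side (T m) / 2] points, which eventually exceeds [t n r_n]. *)
Lemma whp_many_inversions (t eps : R) : 0 <= t -> 0 < eps ->
  whp P (fun n w => (0 < n)%N -> (forall i, ~ split_corners ((t + eps) * r n) (Z n i w)) ->
    t * (n%:R * r n) < (min_inversion (fun i => Z n i w))%:R).
Proof.
move=> t0 e0.
have hl : whp P (fun n w => forall l, forall p, square_set (T l) p ->
    (forall b, ~ triangle (T l) b ((t + eps) * r n) p) ->
    exists A : bool -> set (plane R),
      [/\ forall c q, A c q -> inverted p q,
          forall c c' q, A c q -> A c' q -> c = c' &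
          t * (n%:R * r n) < \sum_c count_in (Z n) (A c) w]).
  apply: whp_forall => l.
  exact: (whp_lower iidZ r0 rcvg nr (hS l) (hBL l true) (hBL l false) (hcb l) t0 e0).
have hc := whp_inner_count (fun m => divr_gt0 (side0 m) (ltr0n R 2)).
have hsmall : \forall n \near \oo, forall m, t * r n <= side (T m) / 2.
  apply: filter_forall => m.
  have : t * r n @[n --> \oo] --> (0 : R).
    by rewrite -[X in _ --> X](mulr0 t); apply: cvgM => //; exact: cvg_cst.
  by move=> /cvgr_le; apply; rewrite divr_gt0.
apply: whpS (whpI hl (whpI hc whp_inner_tiles)) _.
apply: filterS hsmall => n hsm w [{}hl [{}hc hi]] n0 notin.
have n0' : 0 < n%:R :> R by rewrite ltr0n.
have [i ->] := min_inversion_arg (Z n) w n0.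
have [l il] := hi i; have Sl := inner_sub il.
have [lD|/not_splittingP[m lm]] := boolP (l \in splittings T).
  have [|A [h1 h2 h3]] := hl l _ Sl.
    by move=> b tri; apply: (notin i); exists l => //; split => //; case: b tri; [left|right].
  by apply: lt_le_trans h3 _; exact: inversions_ge.
have := inversions_ge (I := unit) (A := fun=> inner (T m)) (w := w) (i := i)
  (fun _ q => inverted_squares_inner hT lm Sl) (fun u v => match u, v with tt, tt => fun _ _ _ => erefl end).
rewrite (bigD1 tt)//= big1 ?addr0; last by case.
apply: lt_le_trans; have := hc m; rewrite ltr_distl => /andP[+ _]; apply: le_lt_trans.
have -> : n%:R * side (T m) - side (T m) / 2 * n%:R = side (T m) / 2 * n%:R by field.
by rewrite mulrCA [leRHS]mulrC ler_wpM2l// ltW.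
Qed.

(** The limit of [n] times the mass of the corner triangles of size [r_n], written corner by corner;
    [limit_massE] identifies it with the integral of [phi] over [Delta]. *)
Definition split_mass : R := \sum_(l in splittings T)
  \sum_b (if a l b == alpha then side (T l) `^ (- alpha) else 0) * Delta_mass (f l b).

(** The distances to the two corners sum to [2 * side (T l)], so the opposite triangles are disjoint
    when [s < side (T l)]. *)
Lemma mu_split_corner l s : s < side (T l) ->
  mu (split_corner l s) = (mu (triangle (T l) true s) + mu (triangle (T l) false s))%E.
Proof.
move=> sd.
have mi := measurable_inner (T l).
have mt b := measurable_triangle (T l) b s.
have e b : mu (triangle (T l) b s `&` inner (T l)) = mu (triangle (T l) b s).
  have mS : measurable (square_set (T l) `\` inner (T l) : set (plane R)).
    by apply: measurableD => //; exact: measurable_square.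
  have S0 : mu (square_set (T l) `\` inner (T l)) = 0%E.
    rewrite measureD//; last first.
    - apply: (@le_lt_trans _ _ 1%E); last exact: ltry.
      by apply: probability_le1; exact: measurable_square.
    - exact: measurable_square.
    rewrite setIidr; last exact: inner_sub.
    transitivity ((side (T l))%:E - (side (T l))%:E)%E; last by rewrite -EFinB subrr.
    by congr (_ - _)%E; [exact: (mu_square (hS l))|exact: (mu_inner (hS l))].
  have mti : measurable (triangle (T l) b s `&` inner (T l)) by exact: measurableI.
  apply/eqP; rewrite eq_le; apply/andP; split.
    by apply: le_measure; rewrite ?inE// => p [].
  rewrite -[leRHS](measureU0 mti mS S0); apply: le_measure; rewrite ?inE//.
    exact: measurableU.
  move=> p tp; have [ip|ip] := pselect (inner (T l) p); first by left.
  by right; split => //; case: tp.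
rewrite /split_corner setIC setIUl measureU; last first.
- rewrite -subset0 => p [[[_ /= h1] _] [[_ /= h2] _]].
  rewrite -/(dist true true (T l) p) in h1.
  have e1 := distC true true (T l) p; have e2 := distC true false (T l) p.
  by rewrite /= in e1 e2; move: h1 h2; rewrite e1 e2; lra.
- exact: measurableI.
- exact: measurableI.
by congr (_ + _)%E; exact: e.
Qed.

Lemma cvg_split_mass (c : R) : 0 < c ->
  n%:R * fine (mu (split_corners (c * r n))) @[n --> \oo] -->
    c `^ (alpha + 1) * split_mass.
Proof.
move=> c0.
have hsmall : \forall n \near \oo, forall l, c * r n < side (T l).
  apply: filter_forall => l.
  have : c * r n @[n --> \oo] --> (0 : R).
    by rewrite -[X in _ --> X](mulr0 c); apply: cvgM => //; exact: cvg_cst.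
  by move=> /cvgr_lt; apply.
rewrite /split_mass mulr_sumr.
have : (fun n => \sum_(l in splittings T) \sum_b
    n%:R * fine (mu (triangle (T l) b (c * r n)))) @ \oo -->
    \sum_(l in splittings T) c `^ (alpha + 1) *
     (\sum_b (if a l b == alpha then side (T l) `^ (- alpha) else 0) * Delta_mass (f l b)).
  apply: cvg_big => [|l lD]; first exact: add_continuous.
  rewrite mulr_sumr; apply: cvg_big => [|b _]; first exact: add_continuous.
  by apply: (cvg_triangle_mass alpha0 (side0 l) (hBL l b) c0); exact: alpha_le.
apply: cvg_trans; apply: near_eq_cvg; apply: filterS hsmall => n hn.
have fm (A : set (plane R)) : measurable A -> mu A = (fine (mu A))%:E.
  by move=> mA; rewrite fineK ?fin_num_measure.
have -> : mu (split_corners (c * r n)) =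
    (\sum_(l in splittings T) \sum_b fine (mu (triangle (T l) b (c * r n))))%:E.
  rewrite /split_corners.
  have -> : \bigcup_(l in [set l | l \in splittings T]) split_corner l (c * r n) =
      \big[setU/set0]_(l < k | l \in splittings T) split_corner l (c * r n).
    rewrite -bigcup_seq_cond; apply/seteqP; split => p [l h hl]; exists l => //=.
      by rewrite mem_index_enum.
    by case/andP : h.
  rewrite measure_bigsetU_ord_cond//; last 2 first.
  - by move=> l _; exact: measurable_split_corner.
  - by move=> l m _ _ [p [[hl _] [hm _]]]; exact: (inner_disjoint hT hl hm).
  rewrite -sumEFin; apply: eq_bigr => l lD.
  rewrite big_bool/= EFinD -!fm; try exact: measurable_triangle.
  exact: mu_split_corner.
by rewrite /= mulr_sumr; apply: eq_bigr => l _; rewrite mulr_sumr.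
Qed.

Definition hit n s : set (Omega n) := [set w | exists i, split_corners s (Z n i w)].

Lemma hitE n s : @hit n s = ~` \bigcap_i (Z n i @^-1` (~` split_corners s)).
Proof.
apply/seteqP; split => w /=.
  by move=> [i hi] /(_ i I).
by move=> h; apply: contrapT => no; apply: h => i _ hi; apply: no; exists i.
Qed.

Lemma measurable_miss n s : measurable (\bigcap_(i in [set: 'I_n]) (Z n i @^-1` (~` split_corners s))).
Proof.
apply: fin_bigcap_measurable => // i _; apply: measurable_preim.
by apply: measurableC; exact: measurable_split_corners.
Qed.

Lemma measurable_hit n s : measurable (@hit n s).
Proof. by rewrite hitE; apply: measurableC; exact: measurable_miss. Qed.

Lemma cvg_hit (c : R) : 0 < c ->
  fine (P n (hit (c * r n))) @[n --> \oo] --> 1 - expR (- (c `^ (alpha + 1) * split_mass)).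
Proof.
move=> c0.
have mE n := measurable_split_corners (c * r n).
have E n : fine (P n (hit (c * r n))) = 1 - (1 - fine (mu (split_corners (c * r n)))) ^+ n.
  rewrite hitE probability_setC; last exact: measurable_miss.
  rewrite (prob_all_in (iidZ n) (measurableC (mE n))).
  rewrite [in LHS]probability_setC; last exact: mE.
  have -> : mu (split_corners (c * r n)) = (fine (mu (split_corners (c * r n))))%:E.
    by rewrite fineK ?fin_num_measure.
  by rewrite -EFinB/=.
under eq_fun do rewrite E.
apply: cvgB; first exact: cvg_cst.
apply: cvg_void_probability; last exact: cvg_split_mass.
move=> n; rewrite fine_ge0//= -lee_fin fineK ?fin_num_measure//.
exact: probability_le1.
Qed.

Definition low_inversion (t : R) n : set (Omega n) :=
  [set w | n%:R `^ (- (alpha / (alpha + 1))) * (min_inversion (fun i => Z n i w))%:R <= t].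

Arguments low_inversion : clear implicits.

Lemma measurable_low_inversion t n : measurable (low_inversion t n).
Proof.
exact: (measurable_min_inversion (Z n)
  (fun m => n%:R `^ (- (alpha / (alpha + 1))) * m%:R <= t)).
Qed.

Lemma low_inversionE t n w : (0 < n)%N -> low_inversion t n w =
  ((min_inversion (fun i => Z n i w))%:R <= t * (n%:R * r n)) :> Prop.
Proof.
move=> n0; have n0' : 0 < n%:R :> R by rewrite ltr0n.
rewrite /low_inversion /= powRN mulrC ler_pdivrMr ?powR_gt0//.
by rewrite /r size_corner_scale.
Qed.

Lemma cvg_low_inversion (nu : probability R R) (t : R) :
  rayleigh (alpha + 1)%:E split_mass nu ->
  P n (low_inversion t n) @[n --> \oo] --> nu `]-oo, t]%classic.
Proof.
move=> hnu; have p0 : 0 < alpha + 1 by rewrite addr_gt0.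
rewrite (rayleigh_cdf t p0 hnu); case: ltP => t0.
  apply: cvg_near_cst; apply: nearW => n.
  rewrite (_ : low_inversion t n = set0) ?measure0// -subset0 => w.
  rewrite /low_inversion /= => h; have := le_lt_trans h t0.
  by rewrite ltNge mulr_ge0// powR_ge0.
have fP n (A : set (Omega n)) : measurable A -> P n A = (fine (P n A))%:E.
  by move=> mA; rewrite fineK ?fin_num_measure.
have ml n := measurable_low_inversion t n.
apply/cvg_EFin; first by apply: nearW => n; rewrite fin_num_measure.
apply/cvgrPdist_le => e e0.
(* One third each for the change of [t] in the limit, the exceptional event and the convergence of
   the hitting probability. *)
have e2 : 0 < e / 3 by rewrite divr_gt0.
have up : \forall n \near \oo, fine (P n (low_inversion t n)) <=
    1 - expR (- (split_mass * t `^ (alpha + 1))) + e.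
  have [s ts hs] := weibull_tail_right split_mass p0 t0 e2.
  have s0 : 0 < s := le_lt_trans t0 ts.
  have st0 : 0 < s - t by rewrite subr_gt0.
  have w1 : whp P (fun n w => low_inversion t n w -> hit (s * r n) w).
    apply: whpS (whp_many_inversions t0 st0) _; exists 1%N => // n /= n0 w hw.
    rewrite low_inversionE// => hlow; apply: contrapT => nohit.
    have : t * (n%:R * r n) < (min_inversion (fun i => Z n i w))%:R.
      apply: hw => // i; rewrite subrKC => hi; apply: nohit; by exists i.
    by rewrite ltNge hlow.
  have := whp_le ml (fun n => measurable_hit n (s * r n)) w1 e2.
  have := cvg_hit s0; move=> /cvgrPdist_le/(_ _ e2).
  apply: filterS2 => n; rewrite ler_norml => /andP[h1 _].
  rewrite (fP _ _ (ml n)) (fP _ _ (measurable_hit n (s * r n))) -EFinD lee_fin.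
  rewrite [split_mass * _]mulrC; lra.
have low : \forall n \near \oo, 1 - expR (- (split_mass * t `^ (alpha + 1))) - e <=
    fine (P n (low_inversion t n)).
  (* At [t = 0] there is no smaller positive size, but the limiting distribution function vanishes
     and the bound is trivial. *)
  move: t0; rewrite le_eqVlt => /orP[/eqP <-|t0].
    apply: nearW => n; rewrite powR0 ?gt_eqF// mulr0 oppr0 expR0 subrr sub0r.
    by apply: (@le_trans _ _ 0); [rewrite oppr_le0 ltW|rewrite fine_ge0].
  have [s [s0 ts hs]] := weibull_tail_left split_mass p0 t0 e2.
  have st0 : 0 < t - s by rewrite subr_gt0.
  have w1 : whp P (fun n w => hit (s * r n) w -> low_inversion t n w).
    apply: whpS (whp_few_inversions (ltW t0) st0) _; exists 1%N => // n /= n0 w hw.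
    by rewrite low_inversionE// => hi; apply: hw; rewrite subKr.
  have := whp_le (fun n => measurable_hit n (s * r n)) ml w1 e2.
  have := cvg_hit s0; move=> /cvgrPdist_le/(_ _ e2).
  apply: filterS2 => n; rewrite ler_norml => /andP[_ h1].
  rewrite (fP _ _ (ml n)) (fP _ _ (measurable_hit n (s * r n))) -EFinD lee_fin.
  rewrite [split_mass * _]mulrC; lra.
by apply: filterS2 up low => n h1 h2 /=; rewrite ler_norml; apply/andP; split; lra.
Qed.

End finite_exponent.

(** * Tilings without splitting: counts of order [n] *)

Section no_splitting.

Lemma whp_square_count (h : R) : 0 < h ->
  whp P (fun n w => forall m,
    `|count_in (Z n) (square_set (T m)) w - n%:R * side (T m)| < h * n%:R).
Proof.
move=> h0; apply: whp_forall => m.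
apply: whpS (whp_count_fixed iidZ (measurable_square (T m)) h0) _.
by apply: nearW => n w; rewrite (mu_square (hS m)).
Qed.

(** At most [k] tiles are inverted with [T l], each contributing an error [h N]. *)
Lemma sum_dev (l : 'I_k) (h : R) (N : R) (u : 'I_k -> R) : 0 <= h -> 0 <= N ->
  (forall m, `|u m - N * side (T m)| < h * N) ->
  antidiag_mass T l * N - k%:R * h * N
    <= \sum_(m in perm_inversions (tiling_perm T) l) u m
    <= antidiag_mass T l * N + k%:R * h * N.
Proof.
move=> h0 N0 hu.
have hk (A : {set 'I_k}) : \sum_(m in A) h * N <= k%:R * h * N.
  rewrite sumr_const -[leLHS]mulr_natl -[leRHS]mulrA ler_wpM2r ?mulr_ge0// ler_nat.
  by rewrite -[leqRHS](card_ord k); exact: max_card.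
rewrite /antidiag_mass mulr_suml; apply/andP; split.
  rewrite lerBlDr (le_trans _ (lerD (lexx _) (hk (perm_inversions (tiling_perm T) l))))//.
  rewrite -big_split/=; apply: ler_sum => m _.
  by have := hu m; rewrite ltr_distl => /andP[+ _]; rewrite mulrC; lra.
rewrite (le_trans _ (lerD (lexx _) (hk (perm_inversions (tiling_perm T) l))))//.
rewrite -big_split/=; apply: ler_sum => m _.
by have := hu m; rewrite ltr_distl => /andP[_]; rewrite [_ * N]mulrC; lra.
Qed.

Lemma whp_antidiag_ge (t : R) : (forall l, t < antidiag_mass T l) ->
  whp P (fun n w => (0 < n)%N -> t * n%:R < (min_inversion (fun i => Z n i w))%:R).
Proof.
move=> tM.
have [h h0 hl] : exists2 h : R, 0 < h & forall l, t + k%:R * h < antidiag_mass T l.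
  have : \forall h \near (0:R)^'+, forall l, t + k%:R * h < antidiag_mass T l.
    apply: filter_forall => l.
    have c : t + k%:R * h @[h --> (0:R)^'+] --> t + k%:R * 0.
      apply: cvgD; first exact: cvg_cst.
      by apply: cvgM; [exact: cvg_cst|apply: cvg_at_right_filter; exact: cvg_id].
    by move/cvgr_lt : c; apply; rewrite mulr0 addr0.
  by move=> /near0_rightP[e e0 he]; exists (e / 2); [rewrite divr_gt0|
    apply: he; rewrite divr_gt0//= ltr_pdivrMr// ltr_pMr// ltr1n].
apply: whpS (whpI (whp_inner_count (fun=> h0)) whp_inner_tiles) _.
apply: nearW => n w [hc hi] n0; have n0' : 0 < n%:R :> R by rewrite ltr0n.
have [i ->] := min_inversion_arg (Z n) w n0.
have [l il] := hi i; have Sl := inner_sub il.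
have := inversions_ge (A := fun m => if m \in perm_inversions (tiling_perm T) l
  then inner (T m) else set0) (Z := Z n) (w := w) (i := i).
move=> /(_ _ _)/le_trans => H; apply: lt_le_trans (H _ _ _ (lexx _)); last 2 first.
- move=> m q; case: ifPn => // ml hq; apply: (inverted_squares_inner hT _ Sl hq).
  by rewrite -perm_inversionsE.
- by move=> m m' q; case: ifP => // _; case: ifP => // _; exact: (inner_disjoint hT).
have -> : \sum_m count_in (Z n) (if m \in perm_inversions (tiling_perm T) l
    then inner (T m) else set0) w =
    \sum_(m in perm_inversions (tiling_perm T) l) count_in (Z n) (inner (T m)) w.
  rewrite [RHS]big_mkcond/=; apply: eq_bigr => m _; case: ifP => // _.
  by rewrite /count_in big1// => j _; rewrite indicE in_set0.
have /andP[+ _] := sum_dev l (ltW h0) (ltW n0') hc; apply: lt_le_trans.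
by rewrite -mulrBl ltr_pM2r// ltrBrDr.
Qed.

(** Some sample point falls in a fixed small triangle at the corner of [T l]. Its inversions lie in
    the tiles inverted with [T l] or in two slabs of width [s] of [T l] itself. *)
Lemma whp_antidiag_le (l : 'I_k) (t : R) : antidiag_mass T l < t ->
  whp P (fun n w => (min_inversion (fun i => Z n i w))%:R <= t * n%:R).
Proof.
move=> Mt; set M := antidiag_mass T l in Mt.
(* The excess over [M] is [k h + 2 (s + h)], at most [3 / 4] of [t - M] for these [h] and [s]. *)
pose h := (t - M) / (4 * (k%:R + 1)).
have k1 : 0 < k%:R + 1 :> R by rewrite ltr_wpDl.
have h0 : 0 < h by rewrite divr_gt0 ?subr_gt0// mulr_gt0.
pose s := Num.min (side (T l)) ((t - M) / 8).
have s0 : 0 < s by rewrite lt_min side0 divr_gt0// subr_gt0.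
have sS : s <= side (T l) by rewrite ge_min lexx.
have st : s <= (t - M) / 8 by rewrite ge_min lexx orbT.
have hslab : whp P (fun n w => forall c,
    `|count_in (Z n) (slab (T l) true c s) w - n%:R * s| < h * n%:R).
  apply: whp_forall => c.
  apply: whpS (whp_count_fixed iidZ (measurable_slab (T l) true c s) h0) _.
  by apply: nearW => n w; rewrite (mu_slab (hS l))//= (ltW s0).
pose tri := triangle (T l) true (s / 2).
have tri0 : 0 < fine (mu tri).
  rewrite fine_gt0//; apply/andP; split.
    by apply: (triangle_mass_gt0 (side0 l) (hBL l true)); rewrite divr_gt0.
  by rewrite ltey_eq fin_num_measure//; exact: measurable_triangle.
(* A deviation strictly smaller than the mean excludes an empty triangle. *)
have htri := whp_count_fixed iidZ (measurable_triangle (T l) true (s / 2)) tri0.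
apply: whpS (whpI (whpI hslab htri) (whpI (whp_square_count h0) whp_inner_tiles)) _.
exists 1%N => // n /= n0 w [[{}hslab {}htri] [hc hi]].
have n0' : 0 < n%:R :> R by rewrite ltr0n.
have [i ti] : exists i, tri (Z n i w).
  apply: contrapT => no; move: htri; rewrite /count_in big1.
    by rewrite sub0r normrN ger0_norm ?mulr_ge0 ?ltW// mulrC ltxx.
  by move=> j _; rewrite indicE memNset// => tj; apply: no; exists j.
pose A (x : 'I_k + bool) : set (plane R) := match x with
  | inl m => if m \in perm_inversions (tiling_perm T) l then square_set (T m) else set0
  | inr c => slab (T l) true c s end.
apply: (@le_trans _ _ (\sum_x count_in (Z n) (A x) w)).
  apply: (@le_trans _ _ #|inversions (fun i => Z n i w) i|%:R).
    by rewrite ler_nat; exact: min_inversion_le.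
  apply: inversions_le => j ij; have [m /inner_sub Sj] := hi j.
  have [lm|nlm] := eqVneq l m; last first.
    exists (inl m); rewrite /A perm_inversionsE//.
    by rewrite (inverted_squares_of_points hT nlm ti.1 Sj ij).
  rewrite -lm in Sj.
  have [Sp /= sp] := ti; have hd := (square_setP _ _).1 Sp.
  have hsp c : dist true c (T l) (Z n i w) < s.
    by have := hd true true; have := hd true false; case: c; lra.
  move: ij; rewrite (inverted_dist true (T l)) => pq.
  have : exists c, dist true c (T l) (Z n j w) < dist true c (T l) (Z n i w).
    have [h1|h1] := ltP (dist true true (T l) (Z n j w)) (dist true true (T l) (Z n i w)).
      by exists true.
    have [h2|h2] := ltP (dist true false (T l) (Z n j w)) (dist true false (T l) (Z n i w)).
      by exists false.
    by move: pq; rewrite ltNge mulr_le0 ?subr_le0.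
  by move=> [c qc]; exists (inr c); split => //=; exact: lt_trans (hsp c).
rewrite big_sumType/= big_bool/=.
have -> : \sum_m count_in (Z n) (if m \in perm_inversions (tiling_perm T) l
    then square_set (T m) else set0) w =
    \sum_(m in perm_inversions (tiling_perm T) l) count_in (Z n) (square_set (T m)) w.
  rewrite [RHS]big_mkcond/=; apply: eq_bigr => m _; case: ifP => // _.
  by rewrite /count_in big1// => j _; rewrite indicE in_set0.
have /andP[_ h1] := sum_dev l (ltW h0) (ltW n0') hc.
have h2 c : count_in (Z n) (slab (T l) true c s) w <= (s + h) * n%:R.
  by have := hslab c; rewrite ltr_distl => /andP[_ /ltW]; rewrite mulrDl [s * _]mulrC.
apply: le_trans (lerD h1 (lerD (h2 true) (h2 false))) _.
rewrite -!mulrDl ler_wpM2r ?(ltW n0')// -/M.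
have hE : k%:R * h + h = (t - M) / 4 by rewrite /h; field; rewrite gt_eqF.
have kh : 0 <= k%:R * h by rewrite mulr_ge0// ltW.
lra.
Qed.

Lemma cvg_low_inversion_oo (nu : probability R R) (M t : R) : rayleigh +oo%E M nu ->
  (exists l, antidiag_mass T l = M) -> (forall l, M <= antidiag_mass T l) -> t != M ->
  P n [set w | n%:R `^ (- 1) * (min_inversion (fun i => Z n i w))%:R <= t]
    @[n --> \oo] --> nu `]-oo, t]%classic.
Proof.
move=> hnu [l lM] hM tM; rewrite (rayleigh_oo_cdf _ hnu).
pose L n : set (Omega n) :=
  [set w | n%:R `^ (- 1) * (min_inversion (fun i => Z n i w))%:R <= t].
have mL n : measurable (L n).
  exact: (measurable_min_inversion (Z n) (fun m => n%:R `^ (- 1) * m%:R <= t)).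
have LE n w : (0 < n)%N -> L n w = ((min_inversion (fun i => Z n i w))%:R <= t * n%:R) :> Prop.
  move=> n0; have n0' : 0 < n%:R :> R by rewrite ltr0n.
  by rewrite /L /= powR_inv1 ?(ltW n0')// mulrC ler_pdivrMr.
have fP n (A : set (Omega n)) : measurable A -> P n A = (fine (P n A))%:E.
  by move=> mA; rewrite fineK ?fin_num_measure.
apply/cvg_EFin; first by apply: nearW => n; rewrite fin_num_measure.
apply/cvgrPdist_le => e e0.
case: ifPn => [Mt|].
  have {}Mt : antidiag_mass T l < t by rewrite lM lt_neqAle eq_sym tM.
  have w1 : whp P (fun n w => setT w -> L n w).
    apply: whpS (whp_antidiag_le Mt) _; exists 1%N => // n /= n0 w hw _.
    by rewrite LE.
  have := whp_le (fun n => measurableT) mL w1 e0.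
  apply: filterS => n /=; rewrite probability_setT (fP _ _ (mL n)) -EFinD lee_fin => h.
  have p1 : fine (P n (L n)) <= 1.
    by rewrite -lee_fin fineK ?fin_num_measure//; exact: probability_le1.
  by rewrite /= ger0_norm ?subr_ge0// lerBlDl.
rewrite -ltNge => Mt.
have w1 : whp P (fun n w => L n w -> set0 w).
  have := whp_antidiag_ge (fun l => lt_le_trans Mt (hM l)).
  move=> /whpS; apply; exists 1%N => // n /= n0 w /(_ n0) hw.
  by rewrite LE// leNgt hw.
have := whp_le mL (fun n => measurable0) w1 e0.
apply: filterS => n /=; rewrite measure0 add0e (fP _ _ (mL n)) lee_fin => h.
by rewrite /= sub0r normrN ger0_norm ?fine_ge0.
Qed.

End no_splitting.
End tiled_sample.

Lemma inf_range_min (R : realType) (I : Type) (u : I -> R) (i : I) :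
  (forall j, u i <= u j) -> inf (range u) = u i.
Proof.
move=> h; apply/eqP; rewrite eq_le; apply/andP; split.
  by apply: ge_inf; [exists (u i) => _ [j _ <-]|exists i].
by apply: lb_le_inf; [exists (u i), i|move=> _ [j _ <-]].
Qed.

(** * Identification of the limiting constant *)

Section limit_mass.
Context {R : realType} {k : nat}.
Variables (T : 'I_k -> square R) (mu : probability (plane R) R).
Variables (a : 'I_k -> bool -> R) (f : 'I_k -> bool -> R * R -> R).
Hypothesis side0 : forall l, 0 < side (T l).
Hypothesis hBL : forall l b, BL_smooth (corner_measure mu (T l) b) (a l b) (f l b).
Variables (al : 'I_k -> R) (ph : 'I_k -> R * R -> R).
Hypotheses (alE : forall l, al l = Num.min (a l true) (a l false))
  (phE : forall l p, quadrant p -> side (T l) `^ al l * ph l p =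
     (if a l true <= a l false then f l true p else 0) +
     (if a l false <= a l true then f l false p else 0)).
Variable alpha : R.
Hypothesis alpha_le : forall l, l \in splittings T -> alpha <= al l.

Let weight l b : R := if a l b == alpha then side (T l) `^ (- alpha) else 0.

Let weight_ge0 l b : 0 <= weight l b.
Proof. by rewrite /weight; case: ifP => // _; exact: powR_ge0. Qed.

(** The factor [side ^ alpha] in [sub_standard] cancels the [side ^ (- alpha)] produced by rescaling
    the triangles. *)
Lemma weighted_densities l p : l \in splittings T -> quadrant p ->
  (if al l == alpha then ph l p else 0) =
  weight l true * f l true p + weight l false * f l false p.
Proof.
move=> lD qp; have ha := alpha_le lD; have hp := phE l qp.
have sN0 : side (T l) `^ alpha != 0 by rewrite gt_eqF// powR_gt0.
rewrite /weight; case: eqVneq => [e|ne]; last first.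
  have lt b : alpha < a l b.
    have : alpha < al l by rewrite lt_neqAle eq_sym ne.
    by rewrite alE lt_min => /andP[]; case: b.
  by rewrite !gt_eqF// !mul0r addr0.
(* Here [alpha] is the minimum of the two corner exponents, so a corner attains it exactly when its
   exponent is at most the other one. *)
have -> : (a l true == alpha) = (a l true <= a l false).
  by rewrite -e alE; case: (leP (a l true)) => h; [rewrite eqxx|rewrite gt_eqF].
have -> : (a l false == alpha) = (a l false <= a l true).
  by rewrite -e alE; case: (ltgtP (a l true)) => h; [rewrite gt_eqF|rewrite eqxx|rewrite h eqxx].
rewrite e in hp; rewrite powRN; apply: (mulfI sN0); rewrite hp mulrDr.
by case: ifP => _; case: ifP => _; rewrite ?mul0r ?mulr0 ?addr0 ?add0r ?mulrA ?mulfV ?mul1r.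
Qed.

Lemma limit_massE (phi : R * R -> R) :
  (forall p, quadrant p -> phi p = \sum_(l in splittings T | al l == alpha) ph l p) ->
  \int[lebesgue2]_(p in Delta) phi p = split_mass T a f alpha.
Proof.
move=> phiE.
have q (p : R * R) : Delta p -> quadrant p.
  by move=> h; apply: unit_square_quadrant; exact: Delta_unit_square.
have mf l b : measurable_fun (Delta : set (plane R)) (f l b).
  exact: (BL_smooth_measurable (hBL l b) measurable_Delta (@Delta_unit_square R)).
have f0 l b p : Delta p -> 0 <= f l b p by move=> /q; exact: BL_smooth_ge0 (hBL l b) p.
pose g l (p : plane R) : \bar R :=
  ((weight l true)%:E * (f l true p)%:E + (weight l false)%:E * (f l false p)%:E)%E.
have mg l : measurable_fun (Delta : set (plane R)) (g l).
  by apply: emeasurable_funD; apply: measurable_funeM; exact/measurable_EFinP.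
have g0 l p : Delta p -> (0 <= g l p)%E.
  by move=> Dp; rewrite adde_ge0// mule_ge0 ?lee_fin// f0.
rewrite /Rintegral.
have -> : (\int[lebesgue2]_(p in Delta) (phi p)%:E =
    \int[lebesgue2]_(p in Delta) (\sum_(l <- enum (splittings T)) g l p))%E.
  apply: eq_integral => p; rewrite inE => Dp; rewrite (phiE _ (q _ Dp)) big_mkcondr/=.
  rewrite big_enum/= -sumEFin; apply: eq_bigr => l lD.
  by rewrite (weighted_densities lD (q _ Dp)) EFinD !EFinM.
rewrite ge0_integral_sum//; last exact: measurable_Delta.
rewrite big_enum/=.
have -> : (\sum_(l in splittings T) \int[lebesgue2]_(p in Delta) g l p)%E =
    (split_mass T a f alpha)%:E; last by [].
rewrite /split_mass -sumEFin; apply: eq_bigr => l lD.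
have wE b : (\int[lebesgue2]_(p in Delta) ((weight l b)%:E * (f l b p)%:E) =
    (weight l b * Delta_mass (f l b))%:E)%E.
  rewrite ge0_integralZl_EFin//.
  - by rewrite (Delta_massE (hBL l b)).
  - exact: measurable_Delta.
  - by move=> p Dp; rewrite lee_fin f0.
  - exact/measurable_EFinP.
rewrite ge0_integralD//.
- by rewrite big_bool/= EFinD -!wE.
- exact: measurable_Delta.
- by move=> p Dp; rewrite mule_ge0 ?lee_fin// f0.
- by apply: measurable_funeM; exact/measurable_EFinP.
- by move=> p Dp; rewrite mule_ge0 ?lee_fin// f0.
- by apply: measurable_funeM; exact/measurable_EFinP.
Qed.

(** One of the two corners of [T l] has exponent [alpha], hence a positive term. Positivity is
    required by [rayleigh_exists]. *)
Lemma split_mass_gt0 l : l \in splittings T -> al l = alpha ->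
  0 < split_mass T a f alpha.
Proof.
move=> lD e.
have D0 m b : 0 < Delta_mass (f m b).
  by rewrite -lte_fin -(Delta_massE (hBL m b)); exact: BL_smooth_Delta_gt0 (hBL m b).
have w0 m b : 0 <= weight m b * Delta_mass (f m b) by rewrite mulr_ge0// ltW.
rewrite /split_mass (bigD1 l)//=; apply: ltr_wpDr.
  by apply: sumr_ge0 => m _; apply: sumr_ge0 => b _; exact: w0.
have [b ab] : exists b, a l b = alpha.
  by rewrite -e alE; case: (leP (a l true)) => _; [exists true|exists false].
rewrite (bigD1 b)//=; apply: ltr_wpDr.
  by apply: sumr_ge0 => c _; exact: w0.
by rewrite ab eqxx mulr_gt0// powR_gt0.
Qed.

End limit_mass.

Theorem theorem1p3 (R : realType) (k : nat) (T : 'I_k -> square R)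
    (alpha : \bar R) (phi : R * R -> R) (mu : probability (plane R) R)
    (d : nat -> measure_display) (Omega : forall n, measurableType (d n))
    (P : forall n, probability (Omega n) R)
    (Z : forall n, 'I_n -> {RV (P n) >-> plane R}) :
  permuton mu ->
  tile_standard T alpha phi mu ->
  (forall n, iid_sample mu (Z n)) ->
  exists nu : probability R R,
    rayleigh (alpha + 1)%E
      (min_antidiag_mass T + \int[lebesgue2]_(p in Delta) phi p) nu /\
    cvg_in_distribution P
      (fun n w => n%:R `^ (- rate alpha) *
                  (min_inversion (fun i => Z n i w))%:R) nu.
Proof.
move=> hmu [hT mu1 [al [ph [hal alphaE phiE]]]] iidZ.
have side0 := tiling_side_gt0 hT.
have /choice[af haf] : forall l, exists af : (bool -> R) * (bool -> R * R -> R),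
    [/\ forall b, BL_smooth (corner_measure mu (T l) b) (af.1 b) (af.2 b),
        al l = Num.min (af.1 true) (af.1 false) &
        forall p, quadrant p -> side (T l) `^ al l * ph l p =
          (if af.1 true <= af.1 false then af.2 true p else 0) +
          (if af.1 false <= af.1 true then af.2 false p else 0)].
  move=> l; have [_ [[am [ap [phim [phip [hm hp e1 e2]]]]] _]] := hal l.
  exists ((fun b => if b then am else ap), (fun b => if b then phim else phip)).
  by split => //; case.
pose a l := (af l).1; pose f l := (af l).2.
have hBL l b : BL_smooth (corner_measure mu (T l) b) (a l b) (f l b).
  by have [h _ _] := haf l; exact: h.
have alE l : al l = Num.min (a l true) (a l false) by have [_ h _] := haf l.
have phE l p : quadrant p -> side (T l) `^ al l * ph l p =
     (if a l true <= a l false then f l true p else 0) +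
     (if a l false <= a l true then f l false p else 0).
  by have [_ _ h] := haf l; exact: h.
have hcb l : corner_balanced (corner_measure mu (T l) true) by have [_ []] := hal l.
have [D0|/set0Pn[l1 l1D]] := eqVneq (splittings T) finset.set0.
  have -> : alpha = +oo%E by rewrite alphaE D0 big_pred0// => l; rewrite inE.
  have -> : \int[lebesgue2]_(p in Delta) phi p = 0.
    rewrite /Rintegral (eq_integral (cst 0%E)) ?integral0// => p; rewrite inE => Dp.
    rewrite phiE; last by apply: unit_square_quadrant; exact: Delta_unit_square.
    by rewrite big_pred0// => l; rewrite D0 inE.
  (* The point [0] must be covered, so there is a tile and the minimum is attained. *)
  have [l2 _ _] : (\bigcup_l axis_side true (T l)) 0.
    by apply: (tiling_cover hT); rewrite /= in_itv/= lexx ler01.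
  have [lM hlM] : exists l, forall m, antidiag_mass T l <= antidiag_mass T m.
    case: (arg_minP (antidiag_mass T) (erefl true : predT l2)) => l _ hl.
    by exists l => m; exact: hl.
  rewrite addr0 /min_antidiag_mass (inf_range_min hlM).
  have [nu hnu] := dirac_probability (antidiag_mass T lM).
  exists nu; split => // t ct.
  have tM : t != antidiag_mass T lM.
    by apply/eqP => e; apply: (rayleigh_oo_discontinuous hnu); rewrite -e.
  apply: (cvg_low_inversion_oo hT hmu mu1 hBL iidZ hnu _ hlM tM).
  by exists lM.
case: (arg_minP al l1D) => l0 l0D hl0.
have aE : alpha = (al l0)%:E.
  rewrite alphaE; apply: le_anti; apply/andP; split; first exact: bigmin_le_cond.
  by apply: le_bigmin => [|l lD]; rewrite ?leey// lee_fin hl0.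
have phiE' p : quadrant p -> phi p = \sum_(l in splittings T | al l == al l0) ph l p.
  by move=> /phiE ->; rewrite aE; apply: eq_bigl => l; rewrite eqe.
have hle l b : l \in splittings T -> al l0 <= a l b.
  by move=> /hl0 /le_trans; apply; rewrite alE; case: b; rewrite ge_min lexx ?orbT.
have al0 : 0 < al l0 := (hal l0).1.
(* A splitting has no inverted tile, hence zero anti-diagonal mass; of the two terms in the Rayleigh
   parameter only the integral remains. *)
have M0 : min_antidiag_mass T = 0.
  have e : antidiag_mass T l0 = 0.
    have : l0 \in splittings T by [].
    by rewrite /antidiag_mass inE => /eqP ->; rewrite big_set0.
  rewrite /min_antidiag_mass (@inf_range_min _ _ _ l0) ?e// => l.
  by apply: sumr_ge0 => m _; exact/ltW/side0.
rewrite M0 add0r (limit_massE side0 hBL alE phE hl0 phiE') aE.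
have B0 := split_mass_gt0 side0 hBL alE l0D (erefl (al l0)).
have [nu hnu] := rayleigh_exists (addr_gt0 al0 ltr01) B0.
exists nu; split => // t _.
exact: (cvg_low_inversion hT hmu mu1 hBL hcb iidZ al0 hle hnu).
Qed.
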